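(* Let $\mathbf f$ be any quadratic, clean and feasible monotone system of polynomials. Then the Newton sequence $(\boldsymbol\nu^{(k)})_{k\in\mathbb N}$ is well-defined and converges linearly to $\mu\mathbf f$; more precisely, there is $k_{\mathbf f}\in\mathbb N$ such that for every $i\ge0$, $\boldsymbol\nu^{(k_{\mathbf f}+i\cdot(h(\mathbf f)+1)\cdot2^{h(\mathbf f)})}$ has at least $i$ valid bits of $\mu\mathbf f$.
   Context: A monotone system of polynomials (MSP) is a map $\mathbf f:\mathbb R_{\ge0}^n\to\mathbb R_{\ge0}^n$ whose components are polynomials with nonnegative real coefficients; feasible: it has a nonnegative fixed point, the least being $\mu\mathbf f$; clean: every variable is positive in some $\mathbf f^k(\mathbf 0)$; quadratic: all monomials have degree $\le2$. The Newton sequence is $\boldsymbol\nu^{(k)}=\mathcal N_{\mathbf f}^k(\mathbf 0)$ with $\mathcal N_{\mathbf f}(\mathbf X)=\mathbf X+(\mathrm{Id}-\mathbf f'(\mathbf X))^{-1}(\mathbf f(\mathbf X)-\mathbf X)$, $\mathbf f'$ the Jacobian. $X_i$ depends directly on $X_k$ if $\partial f_i/\partial X_k\not\equiv0$; strongly connected components (SCCs) are maximal sets of mutually dependent variables (reflexive-transitive closure), forming a DAG with edge $S'\to S$ if a variable of $S$ depends directly on one of $S'\ne S$; the depth of an SCC is the length of the longest DAG path from it to an SCC on which no other SCC depends, and $h(\mathbf f)$ is the maximal depth (height of the DAG). A vector $\boldsymbol\nu$ has $i$ valid bits of $\mu\mathbf f$ if $|(\mu\mathbf f)_j-\nu_j|/|(\mu\mathbf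 f)_j|\le2^{-i}$ for every $j$. *)

(* Defs.v *)
(* The notations of multinomials' [mpoly] clash with those of MathComp-Analysis:
   the file is imported without them, and its constants are written qualified. *)
From HB Require Export structures.
From mathcomp Require Export all_boot all_order all_algebra.
From mathcomp Require Export all_classical all_reals topology normedtype.
From mathcomp Require Export sequences.
From mathcomp Require mpoly.
Export -(notations) mpoly.

Set Implicit Arguments.
Unset Strict Implicit.
Unset Printing Implicit Defensive.

Import Order.TTheory GRing.Theory Num.Theory.
Import numFieldNormedType.Exports.
Local Open Scope ring_scope.

Section MonotoneSystems.
Variables (R : realType) (n : nat).

(* A system of n polynomials in n variables X_0, .., X_(n-1). *)
Definition polysys := 'I_n -> mpoly.mpoly n R.

Implicit Types (f : polysys) (x y mu nu : 'cV[R]_n).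

Definition monotone_system f : Prop :=
  forall i (m : mpoly.multinom n), 0 <= mpoly.mcoeff m (f i).

Definition quadratic f : Prop :=
  forall i (m : mpoly.multinom n),
    m \in mpoly.msupp (f i) -> (mpoly.mdeg m <= 2)%N.

Definition sys_eval f x : 'cV[R]_n :=
  \col_i mpoly.meval (fun j => x j 0) (f i).

Definition jacobian f x : 'M[R]_n :=
  \matrix_(i, j) mpoly.meval (fun k => x k 0) (mpoly.mderiv j (f i)).

Definition le_vec x y : Prop := forall i, x i 0 <= y i 0.

Definition nonneg_fixpoint f x : Prop := le_vec 0 x /\ sys_eval f x = x.

Definition least_nonneg_fixpoint f mu : Prop :=
  nonneg_fixpoint f mu /\ forall x, nonneg_fixpoint f x -> le_vec mu x.

Definition feasible f : Prop := exists x, nonneg_fixpoint f x.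

(* The least nonnegative fixed point; it exists (and is unique) as soon as the
   monotone system is feasible, the default value 0 being irrelevant then. *)
Definition lfp f : 'cV[R]_n :=
  xget 0 [set mu | least_nonneg_fixpoint f mu]%classic.

Definition clean f : Prop :=
  forall i, exists k, 0 < iter k (sys_eval f) 0 i 0.

(* [invmx] is total, so the partiality of the Newton operator is recorded
   separately: it is defined at the points of the nonnegative orthant (the
   domain of the system) where Id - f'(X) is invertible. *)
Definition newton f x : 'cV[R]_n :=
  x + invmx (1%:M - jacobian f x) *m (sys_eval f x - x).

Definition newton_defined f x : Prop :=
  le_vec 0 x /\ 1%:M - jacobian f x \in unitmx.

Definition newton_seq f (k : nat) : 'cV[R]_n := iter k (newton f) 0.

Definition newton_seq_well_defined f : Prop :=
  forall k, newton_defined f (newton_seq f k).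

Definition valid_bits mu nu (i : nat) : Prop :=
  forall j, `|mu j 0 - nu j 0| / `|mu j 0| <= 2 ^- i.

(* Convergence with an error decaying at least geometrically; equivalently
   (for positive l) the number of valid bits of l grows at least linearly. *)
Definition converges_linearly (u : nat -> 'cV[R]_n) (l : 'cV[R]_n) : Prop :=
  (u k @[k --> \oo] --> l)%classic /\
  exists C rho : R, [/\ 0 <= C, 0 <= rho, rho < 1 &
    forall k j, `|u k j 0 - l j 0| <= C * rho ^+ k].

Definition depends_directly f : rel 'I_n :=
  fun i k => mpoly.mderiv k (f i) != 0.

Definition mutually_dependent f : rel 'I_n :=
  fun i j => connect (depends_directly f) i j &&
             connect (depends_directly f) j i.

Definition sccs f : {set {set 'I_n}} :=
  equivalence_partition (mutually_dependent f) [set: 'I_n].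

(* [scc_edge f S' S] is the edge S' -> S: some variable of S depends directly
   on some variable of S'. *)
Definition scc_edge f : rel {set 'I_n} := fun S' S =>
  [&& S' \in sccs f, S \in sccs f, S' != S &
      [exists i in S, exists k in S', depends_directly f i k]].

Definition scc_sink f (S : {set 'I_n}) : bool :=
  (S \in sccs f) && [forall T, ~~ scc_edge f S T].

(* The sequence p lists the vertices visited after S, so the length (number of
   edges) of the path S :: p is the size of p.  Bounding it by n loses nothing:
   see [scc_path_size]. *)
Definition depth f (S : {set 'I_n}) : nat :=
  \max_(l < n.+1 | [exists p : l.-tuple {set 'I_n},
                      path (scc_edge f) S p && scc_sink f (last S p)]) l.

Definition height f : nat := \max_(S in sccs f) depth f S.

Lemma mutually_dependent_equiv f :
  equivalence_rel (mutually_dependent f).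
Proof.
move=> x y z; rewrite /mutually_dependent !connect0; split=> //.
move=> /andP[xy yx]; apply/andP/andP => -[a b]; split.
- exact: connect_trans yx a.
- exact: connect_trans b xy.
- exact: connect_trans xy a.
- exact: connect_trans b yx.
Qed.

Lemma sccs_mutual f S i j :
  S \in sccs f -> i \in S -> j \in S -> connect (depends_directly f) i j.
Proof.
move=> /imsetP[x _ ->]; rewrite !inE /= => /andP[_ ix] /andP[xj _].
exact: connect_trans ix xj.
Qed.

Lemma sccs_eq f S T i j : S \in sccs f -> T \in sccs f -> i \in S -> j \in T ->
  mutually_dependent f i j -> S = T.
Proof.
have md_iff a b c : mutually_dependent f a b ->
    mutually_dependent f a c = mutually_dependent f b c.
  by move=> ab; have [_ ->] := mutually_dependent_equiv f a b c.
move=> /imsetP[x _ ->] /imsetP[y _ ->]; rewrite !inE /= => xi yj ij.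
apply/setP => z; rewrite !inE /=.
by rewrite (md_iff _ _ _ xi) (md_iff _ _ _ yj) (md_iff _ _ _ ij).
Qed.

Lemma scc_path_depends f S p T : path (scc_edge f) S p -> T \in p ->
  exists i j, [/\ i \in T, j \in S & connect (depends_directly f) i j].
Proof.
elim: p S => // U p IHp S /= /andP[/and4P[sS sU _ /exists_inP[i iU]]].
move=> /exists_inP[k kS ik] pp; rewrite in_cons => /orP[/eqP->|Tp].
  by exists i, k; split=> //; apply: connect1.
have [a [b [aT bU ab]]] := IHp _ pp Tp.
exists a, k; split=> //; apply: connect_trans ab _.
by apply: connect_trans (sccs_mutual sU bU iU) (connect1 ik).
Qed.

Lemma scc_path_uniq f S p : path (scc_edge f) S p -> uniq (S :: p).
Proof.
elim: p S => // U p IHp S Sp; rewrite cons_uniq.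
move: (Sp) => /= /andP[/and4P[sS sU SU /exists_inP[i iU /exists_inP[k kS ik]]] pp].
rewrite -[(U \notin p) && _]/(uniq (U :: p)) (IHp _ pp) andbT.
rewrite in_cons negb_or SU; apply/negP => Sp'.
have [a [b [aS bU ab]]] := scc_path_depends pp Sp'.
case/eqP: SU; apply: (sccs_eq sS sU aS bU); rewrite /mutually_dependent ab /=.
apply: connect_trans (sccs_mutual sU bU iU) _.
by apply: connect_trans (connect1 ik) (sccs_mutual sS kS aS).
Qed.

Lemma scc_path_size f S p : path (scc_edge f) S p -> (size p <= n)%N.
Proof.
move=> Sp; have /= /andP[_ up] := scc_path_uniq Sp.
have sub : {subset p <= enum (sccs f)}.
  move=> T Tp; rewrite mem_enum.
  elim: p S Sp {up} Tp => //= U p IHp S /andP[/and4P[_ sU _ _] pp].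
  by rewrite in_cons => /orP[/eqP->//|]; apply: IHp pp.
apply: leq_trans (uniq_leq_size up sub) _; rewrite -cardE.
by apply: leq_trans (leq_imset_card _ _) _; rewrite cardsT card_ord.
Qed.

End MonotoneSystems.

(* Main.v *)
(** Write f(x) = c + L x + B(x, x), J(x) = L + 2 B(x, .), and let e = mu - x be
    the error of a point x with x <= f(x) and e' that of N(x).  Then
    e >= J(x) e + B(e, e) and e' = J(x) e' + B(e, e).  The first inequality makes
    the entries of e inside an SCC S comparable.  Applied to lower iterates
    strictly below mu and normalised, it yields in the limit a vector d > 0 with
    J_SS(mu) d <= d for every S.  Either this is strict somewhere in S or f_S is
    genuinely quadratic in the variables of S; so, by a maximum principle,
    (I - J_SS(x))^-1 is nonnegative and of size O(1 / min e_S).  If e_S <= lam d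
    and the errors of the SCCs below S are at most eps, then
    e'_S <= lam/2 d + O(eps / lam) unless e_S is already much smaller than lam d.
    So Newton's rate is 1/2 on the bottom SCCs, and each level replaces the rate
    by its square root: an SCC with t levels below it has rate 2^(-1/2^t). *)
Require Import Defs.
From mathcomp Require Import ring lra.
Set Implicit Arguments.
Unset Strict Implicit.
Unset Printing Implicit Defensive.
Import Order.TTheory GRing.Theory Num.Theory.
Import numFieldNormedType.Exports.
Local Open Scope ring_scope.

(** * Quadratic maps with nonnegative coefficients *)

Lemma exists_argmax (R : realDomainType) (I : finType) (P : pred I) (F : I -> R)
    (i0 : I) : P i0 -> exists2 i1, P i1 & forall i, P i -> F i <= F i1.
Proof. by move=> Pi0; case: (Order.TotalTheory.arg_maxP F Pi0) => i1; exists i1. Qed.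

Lemma exists_argmin (R : realDomainType) (I : finType) (P : pred I) (F : I -> R)
    (i0 : I) : P i0 -> exists2 i1, P i1 & forall i, P i -> F i1 <= F i.
Proof. by move=> Pi0; case: (Order.TotalTheory.arg_minP F Pi0) => i1; exists i1. Qed.

Lemma ler_sum_term (R : numDomainType) (I : finType) (P : pred I) (F : I -> R)
    (j : I) : P j -> (forall i, P i -> 0 <= F i) -> F j <= \sum_(i | P i) F i.
Proof.
move=> Pj F_ge0; rewrite (bigD1 j) //= lerDl.
by apply: sumr_ge0 => i /andP[/F_ge0].
Qed.

(** Each edge costs a factor [a] and one defect [g]; as [a <= 1], the defects just add up. A simple
    path has fewer than [#|I|] edges, which makes the bound uniform. *)
Lemma connect_chain (R : realFieldType) (I : finType) (r : rel I) (D : I -> R)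
    (a g t : R) (i i0 : I) :
  0 <= a <= 1 -> 0 <= g -> 0 <= t ->
  (forall i j, r i j -> a * D j - g <= D i) -> t - g <= D i0 ->
  connect r i i0 -> a ^+ #|I| * t - #|I|.+1%:R * g <= D i.
Proof.
move=> /andP[a_ge0 a_le1] g_ge0 t_ge0 rD tD /connectP[p' p'P i0E].
case/shortenP: p'P i0E => p pP p_uniq _ i0E.
have size_p : (size p < #|I|)%N.
  by rewrite -[X in (X <= _)%N]/(size (i :: p)) -(card_uniqP p_uniq) max_card.
have: a ^+ size p * t - (size p).+1%:R * g <= D i.
  elim: p i {p_uniq size_p p' } pP i0E => [|j p IHp] i /=.
    by move=> _ <-; rewrite expr0 !mul1r.
  move=> /andP[rij pP] i0E.
  have := IHp _ pP i0E; have := rD _ _ rij.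
  set s := (size p).+1; rewrite exprS => h1 h2.
  apply: le_trans h1.
  have: a * (a ^+ size p * t - s%:R * g) <= a * D j by rewrite ler_wpM2l.
  have: a * (s%:R * g) <= s%:R * g by rewrite ler_piMl // mulr_ge0.
  rewrite -[s.+1]addn1 natrD; lra.
apply: le_trans; apply: lerB.
  by apply: ler_wpM2r => //; apply: ler_wiXn2l => //; apply: ltnW.
by apply: ler_wpM2r => //; rewrite ler_nat ltnS ltnW.
Qed.

(** A vertex on the path reaches [j], hence [i], so the path never leaves the component. *)
Lemma connect_within (I : finType) (r : rel I) (i j : I) :
  connect r i j -> connect r j i ->
  connect [rel x y | r x y && (connect r x y && connect r y x)] i j.
Proof.
move=> /connectP[p pP ->]; elim: p i pP => [|k p IHp] i //= /andP[rik pP] ji.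
have ki : connect r k i by apply: connect_trans ji; apply/connectP; exists p.
apply: (@connect_trans _ _ k); first by apply: connect1; rewrite /= rik ki connect1.
by apply: IHp => //; apply: connect_trans ji (connect1 rik).
Qed.

Section QuadraticSystem.
Variables (R : realFieldType) (I : finType).
Variables (c : I -> R) (L : I -> I -> R) (B : I -> I -> I -> R).
Hypotheses (c_ge0 : forall i, 0 <= c i) (L_ge0 : forall i j, 0 <= L i j).
Hypotheses (B_ge0 : forall i j k, 0 <= B i j k).
Hypothesis (B_sym : forall i j k, B i j k = B i k j).

Implicit Types (x y e u v w : I -> R).

Definition qform x i := \sum_j \sum_k B i j k * (x j * x k).
Definition qeval x i := c i + \sum_j L i j * x j + qform x i.
Definition qjac x i j := L i j + 2 * \sum_k B i j k * x k.

Lemma qform_ge0 x i : (forall j, 0 <= x j) -> 0 <= qform x i.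
Proof.
by move=> x0; apply: sumr_ge0 => j _; apply: sumr_ge0 => k _; rewrite !mulr_ge0.
Qed.

Lemma qjac_ge0 x i j : (forall j, 0 <= x j) -> 0 <= qjac x i j.
Proof.
move=> x0; rewrite addr_ge0 // mulr_ge0 //.
by apply: sumr_ge0 => k _; rewrite mulr_ge0.
Qed.

Lemma ler_qjac x y i j : (forall j, x j <= y j) -> qjac x i j <= qjac y i j.
Proof.
move=> xy; rewrite lerD2l ler_wpM2l //; apply: ler_sum => k _.
exact: ler_wpM2l.
Qed.

Lemma ler_qeval x y i : (forall j, 0 <= x j) -> (forall j, x j <= y j) ->
  qeval x i <= qeval y i.
Proof.
move=> x0 xy; apply: lerD.
  by rewrite lerD2l; apply: ler_sum => k _; exact: ler_wpM2l.
apply: ler_sum => j _; apply: ler_sum => k _; apply: ler_wpM2l => //.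
exact: ler_pM.
Qed.

Lemma qeval_ge0 x i : (forall j, 0 <= x j) -> 0 <= qeval x i.
Proof.
by move=> x0; rewrite !addr_ge0 ?qform_ge0 // sumr_ge0 // => j _; rewrite mulr_ge0.
Qed.

Lemma iter_qeval_bound (z : I -> R) k i :
  (forall i, 0 <= z i) -> (forall i, qeval z i = z i) ->
  0 <= iter k qeval (fun=> 0) i <= z i.
Proof.
move=> z0 zfix; elim: k i => [|k IHk] i /=; first by rewrite lexx z0.
have h0 j : 0 <= iter k qeval (fun=> 0) j by case/andP: (IHk j).
have h1 j : iter k qeval (fun=> 0) j <= z j by case/andP: (IHk j).
by rewrite -[z i]zfix ler_qeval // andbT qeval_ge0.
Qed.

(** Exact, since the map has degree two; symmetry of [B] merges the two mixed sums into the factor 2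
    of [qjac]. *)
Lemma qeval_taylor x y i :
  qeval y i = qeval x i + \sum_j qjac x i j * (y j - x j)
              + qform (fun j => y j - x j) i.
Proof.
rewrite /qeval /qform.
have -> : \sum_j qjac x i j * (y j - x j) = \sum_j L i j * y j -
   \sum_j L i j * x j + (\sum_j \sum_k B i j k * (x k * (y j - x j))
     + \sum_j \sum_k B i j k * (x j * (y k - x k))).
  rewrite [X in _ + (_ + X)]exchange_big /= -!big_split -sumrB -big_split /=.
  apply: eq_bigr => j _; rewrite /qjac -big_split /=.
  rewrite mulrDl -mulrBr; congr (_ + _).
  rewrite -mulrA mulr_suml mulr_sumr; apply: eq_bigr => k _.
  by rewrite (B_sym i k j); ring.
set S1 := \sum_j L i j * y j; set S2 := \sum_j L i j * x j.
have -> : \sum_j \sum_k B i j k * (y j * y k) =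
  \sum_j \sum_k B i j k * (x j * x k) +
  (\sum_j \sum_k B i j k * (x k * (y j - x j))
     + \sum_j \sum_k B i j k * (x j * (y k - x k))) +
  \sum_j \sum_k B i j k * ((y j - x j) * (y k - x k)).
  rewrite -!big_split; apply: eq_bigr => j _ /=.
  by rewrite -!big_split; apply: eq_bigr => k _ /=; ring.
ring.
Qed.

(* [x + e = mu] makes [qjac x] plus the [e]-part of the quadratic form at least
   the Jacobian at the midpoint of [x] and [mu]. *)
Lemma half_qjac_le (mu x e v : I -> R) i j :
  (forall j, 0 <= x j) -> (forall j, 0 <= v j) -> (forall j, v j <= e j) ->
  (forall j, x j + e j = mu j) ->
  qjac mu i j / 2 * v j <= \sum_k qjac x i k * v k + qform e i.
Proof.
move=> x0 v0 ve xe.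
have e0 k : 0 <= e k by apply: le_trans (ve k).
apply: (@le_trans _ _ (\sum_k (qjac x i k + \sum_l B i k l * e l) * v k)).
  apply: le_trans (ler_sum_term (j := j) _ _) => //; last first.
    move=> k _; rewrite mulr_ge0 // addr_ge0 ?qjac_ge0 //.
    by apply: sumr_ge0 => l _; rewrite mulr_ge0.
  apply: ler_wpM2r => //; rewrite /qjac.
  have -> : \sum_k B i j k * mu k = \sum_k B i j k * x k + \sum_k B i j k * e k.
    by rewrite -big_split; apply: eq_bigr => k _; rewrite -xe mulrDr.
  have : 0 <= \sum_k B i j k * x k by apply: sumr_ge0 => k _; rewrite mulr_ge0.
  have := L_ge0 i j.
  lra.
rewrite -big_split; apply: ler_sum => k _ /=; rewrite mulrDl lerD2l mulr_suml.
apply: ler_sum => l _; rewrite -mulrA ler_wpM2l // mulrC.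
exact: ler_wpM2r.
Qed.

(** * Comparing entries inside a strongly connected component *)

Variable dep : rel I.
Let eqv i j := connect dep i j && connect dep j i.

Lemma eqv_refl i : eqv i i. Proof. by rewrite /eqv connect0. Qed.
Lemma eqv_sym i j : eqv i j = eqv j i. Proof. by rewrite /eqv andbC. Qed.
Lemma eqv_trans j i k : eqv i j -> eqv j k -> eqv i k.
Proof.
move=> /andP[ij ji] /andP[jk kj].
by rewrite /eqv (connect_trans ij jk) (connect_trans kj ji).
Qed.

Variables (mu : I -> R) (a : R).
Hypotheses (mu_gt0 : forall i, 0 < mu i) (mu_fix : forall i, qeval mu i = mu i).
Hypotheses (a_gt0 : 0 < a) (a_le1 : a <= 1).
(** The factor 2 leaves room for [half_qjac_le]: half of the entry is still at least [a]. *)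
Hypothesis dep_jac2 : forall i j, dep i j -> 2 * a <= qjac mu i j.
Hypothesis ndep_jac : forall i j, ~~ dep i j -> qjac mu i j = 0.

Let dep_jac i j : dep i j -> a <= qjac mu i j.
Proof. by move=> /dep_jac2 h; have := a_gt0; lra. Qed.

Lemma scc_chain (D : I -> R) (g t : R) i0 i :
  0 <= g -> 0 <= t -> eqv i i0 ->
  (forall i j, eqv i i0 -> eqv i j -> dep i j -> a * D j - g <= D i) ->
  t - g <= D i0 -> a ^+ #|I| * t - #|I|.+1%:R * g <= D i.
Proof.
move=> g0 t0 ii0 depD tD.
have [ci1 ci2] := andP ii0.
(* Off the component this constant turns the edge inequality into [0 <= a^-1 * g]. *)
pose D' j := if eqv j i0 then D j else a ^-1 * g.
suff : a ^+ #|I| * t - #|I|.+1%:R * g <= D' i by rewrite /D' ii0.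
apply: (@connect_chain _ _ [rel x y | dep x y && eqv x y] D' a g t _ i0) => //.
- by rewrite ltW.
- move=> k l /andP[dkl ekl]; rewrite /D'.
  have -> : eqv l i0 = eqv k i0.
    apply/idP/idP; first exact: eqv_trans.
    by apply: eqv_trans; rewrite eqv_sym.
  case: ifP => ki0; first exact: depD.
  by rewrite mulVKf ?gt_eqF // subrr mulr_ge0 // invr_ge0 ltW.
- by rewrite /D' eqv_refl.
exact: connect_within.
Qed.

Lemma postfix_error x i : (forall i, x i <= qeval x i) ->
  \sum_j qjac x i j * (mu j - x j) + qform (fun j => mu j - x j) i <= mu i - x i.
Proof.
move=> xq; have := qeval_taylor x mu i; rewrite mu_fix; have := xq i; lra.
Qed.

(** By [postfix_error] and [half_qjac_le], an edge from [k] to [l] gives [a * e l <= e k] for the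
    error [e]; chaining these compares all entries of a component. *)
Lemma postfix_error_ratio x i j :
  (forall i, 0 <= x i) -> (forall i, x i <= mu i) ->
  (forall i, x i <= qeval x i) -> eqv i j ->
  a ^+ #|I| * (mu i - x i) <= mu j - x j.
Proof.
move=> x0 xmu xq ij.
have e0 k : 0 <= mu k - x k by rewrite subr_ge0.
have := @scc_chain (fun k => mu k - x k) 0 (mu i - x i) i j (lexx _) (e0 i).
rewrite mulr0 !subr0; apply=> //; first by rewrite eqv_sym.
move=> k l _ _ dkl; rewrite subr0; apply: le_trans (postfix_error k xq).
apply: le_trans (half_qjac_le k l x0 e0 (fun=> lexx _) (fun=> subrKC _ _)).
by apply: ler_wpM2r => //; have := dep_jac2 dkl; lra.
Qed.

(** * Slack and the maximum principle on one component *)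

Variable d : I -> R.
Hypotheses (d_gt0 : forall i, 0 < d i).
Hypothesis d_sub : forall i, \sum_(j | eqv i j) qjac mu i j * d j <= d i.

(** Nonnegative for [x <= mu] by [d_sub]; where it is positive, [d] is strictly superharmonic for
    the diagonal block of the Jacobian at [x]. *)
Definition slack x i := d i - \sum_(j | eqv i j) qjac x i j * d j.

Definition mp_const : R := #|I|.+1%:R / a ^+ #|I|.

Lemma mp_const_gt0 : 0 < mp_const.
Proof. by rewrite divr_gt0 // exprn_gt0. Qed.

(* Replacing [u] by its positive part bounds the defect [t d - v] by [t d], so
   the slack of [d] at [x < mu] compensates for the smallness of [qjac x]
   against [qjac mu] along the edges. *)
Lemma scc_max_principle x u g tau i0 :
  (forall i, 0 <= x i) -> (forall i, x i <= mu i) -> 0 <= g -> 0 < tau ->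
  tau <= slack x i0 ->
  (forall i, eqv i0 i -> u i <= \sum_(j | eqv i j) qjac x i j * u j + g) ->
  forall i, eqv i0 i -> u i <= mp_const * g / tau * d i.
Proof.
move=> x0 xmu g0 tau0 tau_slack u_sub i i0i.
pose v i := Num.max (u i) 0.
have v0 k : 0 <= v k by rewrite le_max lexx orbT.
have v_sub k : eqv i0 k -> v k <= \sum_(j | eqv k j) qjac x k j * v j + g.
  move=> i0k; rewrite ge_max; apply/andP; split.
    apply: le_trans (u_sub _ i0k) _; rewrite lerD2r; apply: ler_sum => j _.
    by apply: ler_wpM2l; [exact: qjac_ge0 | rewrite le_max lexx].
  by rewrite addr_ge0 // sumr_ge0 // => j _; rewrite mulr_ge0 // qjac_ge0.
(* [t] is the least factor with [v <= t * d] on the component, so [D] is nonnegative there and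
   vanishes at [i1]. *)
have [i1 i01 i1max] := exists_argmax (fun i => v i / d i) (eqv_refl i0).
set t := v i1 / d i1.
have t0 : 0 <= t by rewrite divr_ge0 // ltW.
have vt k : eqv i0 k -> v k <= t * d k by move=> /i1max; rewrite ler_pdivrMr.
pose D k := t * d k - v k.
have D_ge k : eqv i0 k -> \sum_(j | eqv k j) qjac x k j * D j + t * slack x k - g <= D k.
  move=> i0k; have := v_sub _ i0k.
  suff -> : \sum_(j | eqv k j) qjac x k j * D j =
     t * (d k - slack x k) - \sum_(j | eqv k j) qjac x k j * v j.
    by rewrite /D; lra.
  rewrite /slack subKr mulr_sumr -sumrB; apply: eq_bigr => j _.
  by rewrite /D; ring.
have i10 : eqv i1 i0 by rewrite eqv_sym.
have := @scc_chain D g (t * tau) i0 i1 g0 (mulr_ge0 t0 (ltW tau0)) i10.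
have -> : D i1 = 0 by rewrite /D /t divfK ?subrr // gt_eqF.
(* Chaining from [i1], where [D] is 0, to [i0], where the slack gives [D >= t * tau - g], bounds
   [t]. *)
move=> chain; have {chain} : a ^+ #|I| * (t * tau) - #|I|.+1%:R * g <= 0.
  apply: chain => [k l ki0 kl dkl|]; last first.
    apply: le_trans (D_ge _ (eqv_refl i0)); rewrite lerD2r.
    rewrite -[X in X <= _]add0r; apply: lerD; last exact: ler_wpM2l.
    apply: sumr_ge0 => j i0j; rewrite mulr_ge0 ?qjac_ge0 // subr_ge0.
    exact: vt.
  have i0k : eqv i0 k by rewrite eqv_sym.
  apply: le_trans (D_ge _ i0k); rewrite lerD2r.
  have D0 j : eqv k j -> 0 <= D j.
    by move=> kj; rewrite subr_ge0; apply: vt; apply: eqv_trans kj.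
  have h1 : qjac x k l * D l <= \sum_(j | eqv k j) qjac x k j * D j.
    by apply: (ler_sum_term kl) => j kj; rewrite mulr_ge0 ?qjac_ge0 ?D0.
  have h2 : (qjac mu k l - qjac x k l) * d l <= slack x k.
    have := d_sub k; rewrite /slack.
    suff : (qjac mu k l - qjac x k l) * d l <=
       \sum_(j | eqv k j) qjac mu k j * d j - \sum_(j | eqv k j) qjac x k j * d j.
      by lra.
    rewrite -sumrB; under eq_bigr => j _ do rewrite -mulrBl.
    apply: (ler_sum_term kl) => j _.
    by rewrite mulr_ge0 ?subr_ge0 ?ler_qjac // ltW.
  have h3 : (qjac mu k l - qjac x k l) * D l <= t * slack x k.
    apply: (@le_trans _ _ ((qjac mu k l - qjac x k l) * (t * d l))).
      apply: ler_wpM2l; first by rewrite subr_ge0 ler_qjac.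
      by rewrite lerBlDr lerDl.
    by rewrite mulrCA ler_wpM2l.
  have h4 : a * D l <= qjac mu k l * D l by rewrite ler_wpM2r ?D0 ?dep_jac.
  by apply: le_trans h4 _; lra.
rewrite subr_le0 => h.
have: t <= mp_const * g / tau.
  rewrite ler_pdivlMr // /mp_const [X in _ <= X]mulrAC ler_pdivlMr ?exprn_gt0 //.
  by rewrite [X in X <= _]mulrC.
move=> tle; apply: le_trans (_ : v i <= _); first by rewrite le_max lexx.
apply: le_trans (vt _ i0i) _; apply: ler_wpM2r => //; exact: ltW.
Qed.

(** * Maximum principle over all components, and where slack comes from *)

Variable lev : I -> nat.
Hypothesis lev_eq : forall i j, eqv i j -> lev i = lev j.
Hypothesis lev_lt : forall i j, dep i j -> ~~ eqv i j -> (lev j < lev i)%N.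

Lemma qjac_ndep x i j : (forall j, 0 <= x j) -> (forall j, x j <= mu j) ->
  ~~ dep i j -> qjac x i j = 0.
Proof.
move=> x0 xmu /ndep_jac muE; apply/eqP; rewrite eq_le qjac_ge0 // andbT.
by rewrite -muE ler_qjac.
Qed.

(** Induction on the level: lower components contribute nonpositively, so [scc_max_principle]
    applies with [g = 0]. *)
Lemma max_principle x u :
  (forall i, 0 <= x i) -> (forall i, x i <= mu i) ->
  (forall i, exists2 i0, eqv i i0 & 0 < slack x i0) ->
  (forall i, u i <= \sum_j qjac x i j * u j) -> forall i, u i <= 0.
Proof.
move=> x0 xmu sl u_sub.
suff H N : forall i, (lev i < N)%N -> u i <= 0 by move=> i; apply: (H (lev i).+1).
elim: N => // N IHN i levi.
have [i0 ii0 sl0] := sl i.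
have -> : (0 : R) = mp_const * 0 / slack x i0 * d i by rewrite mulr0 !mul0r.
apply: (scc_max_principle x0 xmu (lexx 0) sl0 (lexx _) (u := u)); last by rewrite eqv_sym.
move=> k i0k; rewrite addr0; apply: le_trans (u_sub k) _.
rewrite (bigID (eqv k)) /= gerDl; apply: sumr_le0 => j kj.
have [dkj|/qjac_ndep->//] := boolP (dep k j); last by rewrite mul0r.
apply: mulr_ge0_le0; first exact: qjac_ge0.
apply: IHN; apply: (leq_trans (lev_lt dkj kj)).
by rewrite -(lev_eq i0k) -(lev_eq ii0) -ltnS.
Qed.

(** Here the diagonal block of the Jacobian varies with the component's own variables, so errors
    there create slack. *)
Definition quadratic_scc i :=
  exists p j k, [/\ eqv i p, eqv i j, eqv i k & 0 < B p j k].

Lemma quadratic_scc_eqv i j : eqv i j -> quadratic_scc i -> quadratic_scc j.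
Proof.
move=> ij [p [k [l [ip ik il Bp]]]].
by exists p, k, l; split=> //; apply: eqv_trans _ _; rewrite ?(eqv_sym j); eauto.
Qed.

Hypothesis clean_iter : forall i, exists k, 0 < iter k qeval (fun=> 0) i.

(* If the component were linear in itself with [d] a fixed vector, comparing
   [mu] with the largest [t d] below it would force [mu = t d] there and make
   the inhomogeneous part vanish, so the component would never leave 0. *)
Lemma slack_or_quadratic i :
  (exists2 i0, eqv i i0 & 0 < slack mu i0) \/ quadratic_scc i.
Proof.
apply: or_asboolP; rewrite -implyNb; apply/implyP => /asboolP nsl.
apply/asboolP; apply: contrapT => nquad.
have crit k : eqv i k -> d k = \sum_(j | eqv k j) qjac mu k j * d j.
  move=> ik; apply/eqP; rewrite eq_le d_sub andbT leNgt; apply/negP => sl.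
  by apply: nsl; exists k => //; rewrite subr_gt0.
have B0 p j k : eqv i p -> eqv i j -> eqv i k -> B p j k = 0.
  move=> ip ij ik; apply/eqP; rewrite eq_le B_ge0 andbT leNgt; apply/negP => Bp.
  by apply: nquad; exists p, j, k.
(* With the component set to 0, [qeval z] is the inhomogeneous part of its equations. *)
pose z k := if eqv i k then 0 else mu k.
have z0 k : 0 <= z k by rewrite /z; case: ifP => // _; exact: ltW.
have mu_lin k : eqv i k -> mu k = qeval z k + \sum_(j | eqv k j) qjac mu k j * mu j.
  move=> ik; have kE : eqv k =1 eqv i.
    move=> j; apply/idP/idP; first exact: eqv_trans.
    by apply: eqv_trans; rewrite eqv_sym.
  rewrite -{1}mu_fix (qeval_taylor z) -addrA; congr (_ + _).
  have mzE j : mu j - z j = if eqv i j then mu j else 0.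
    by rewrite /z; case: ifP; rewrite ?subr0 ?subrr.
  have -> : qform (fun j => mu j - z j) k = 0.
    apply: big1 => j _; apply: big1 => l _; rewrite !mzE.
    case: ifP => ij; last by rewrite mul0r mulr0.
    case: ifP => il; last by rewrite !mulr0.
    by rewrite B0 ?mul0r.
  rewrite addr0 [RHS]big_mkcond; apply: eq_bigr => j _ /=.
  rewrite mzE kE; case: ifP => ij; last by rewrite mulr0.
  congr (_ * _); rewrite /qjac; congr (_ + 2 * _).
  apply: eq_bigr => l _; rewrite /z; case: ifP => // il.
  by rewrite B0 // !mul0r.
(* [t] is the largest factor with [t * d <= mu] on the component; the difference [D] vanishes at
   [i1]. *)
have [i1 ii1 i1min] := exists_argmin (fun i => mu i / d i) (eqv_refl i).
pose t := mu i1 / d i1.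
pose D k := mu k - t * d k.
have D0 k : eqv i k -> 0 <= D k.
  by move=> ik; rewrite subr_ge0 -ler_pdivlMr //; apply: i1min.
have DE k : eqv i k -> D k = qeval z k + \sum_(j | eqv k j) qjac mu k j * D j.
  move=> ik; rewrite {1}/D mu_lin // crit // -addrA; congr (_ + _).
  by rewrite mulr_sumr -sumrB; apply: eq_bigr => j _; rewrite /D; ring.
have mu0 k : 0 <= mu k by rewrite ltW.
have qz0 k : 0 <= qeval z k by exact: qeval_ge0.
(* The zero of [D] at [i1] spreads over the component and, by [DE], kills the inhomogeneous part. *)
have qz k : eqv i k -> qeval z k = 0.
  move=> ik; apply/eqP; rewrite eq_le qz0 andbT.
  have := @scc_chain D 0 (D k) k i1 (lexx _) (D0 _ ik).
  rewrite mulr0 !subr0 => chain.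
  have : a ^+ #|I| * D k <= D i1.
    apply: chain => //; first by apply: eqv_trans ik; rewrite eqv_sym.
    move=> p l pk pl dpl; rewrite subr0.
    have ip : eqv i p by apply: eqv_trans ik _; rewrite eqv_sym.
    rewrite (DE p) //; apply: le_trans (_ : qjac mu p l * D l <= _).
      by apply: ler_wpM2r; [apply: D0; exact: eqv_trans ip pl | apply: dep_jac].
    apply: (@le_trans _ _ (\sum_(j | eqv p j) qjac mu p j * D j)); last by rewrite lerDr.
    apply: (ler_sum_term pl) => j pj; rewrite mulr_ge0 ?qjac_ge0 //; apply: D0.
    exact: eqv_trans ip pj.
  have -> : D i1 = 0 by rewrite /D /t divfK ?subrr // gt_eqF.
  rewrite pmulr_rle0 ?exprn_gt0 // => Dk; apply: le_trans Dk.
  rewrite (DE k) // lerDl; apply: sumr_ge0 => j kj.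
  by rewrite mulr_ge0 ?qjac_ge0 // D0 // (eqv_trans ik).
have [k] := clean_iter i; apply/negP; rewrite -leNgt.
suff H p : eqv i p -> iter k qeval (fun=> 0) p <= 0 by apply: H (eqv_refl i).
elim: k p => [|k IHk] p ip //=.
rewrite -[X in _ <= X](qz _ ip); apply: ler_qeval => j.
  by case/andP: (iter_qeval_bound k j mu0 mu_fix).
rewrite /z; case: ifP => [ij|_]; first exact: IHk.
by case/andP: (iter_qeval_bound k j mu0 mu_fix).
Qed.

Lemma qjac_sub x i j :
  qjac mu i j - qjac x i j = 2 * \sum_k B i j k * (mu k - x k).
Proof.
under [in RHS]eq_bigr => k _ do rewrite mulrBr.
by rewrite sumrB /qjac; ring.
Qed.

Lemma slack_ge x i :
  \sum_(j | eqv i j) 2 * (\sum_k B i j k * (mu k - x k)) * d j <= slack x i.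
Proof.
under eq_bigr => j _ do rewrite -qjac_sub mulrBl.
by rewrite sumrB lerD2r.
Qed.

Lemma slack_ge_term x p j k : (forall i, x i <= mu i) -> eqv p j ->
  2 * B p j k * (mu k - x k) * d j <= slack x p.
Proof.
move=> xmu pj; apply: le_trans (slack_ge x p).
have e0 l : 0 <= mu l - x l by rewrite subr_ge0.
have b0 l : 0 <= \sum_k B p l k * (mu k - x k).
  by apply: sumr_ge0 => m _; rewrite mulr_ge0.
apply: (@le_trans _ _ (2 * (\sum_k B p j k * (mu k - x k)) * d j)); last first.
  by apply: (ler_sum_term pj) => l _; rewrite !mulr_ge0 // ltW.
apply: ler_wpM2r; first exact: ltW.
rewrite -mulrA ler_wpM2l //.
apply: (@ler_sum_term _ _ xpredT (fun k => B p j k * (mu k - x k)) k) => // l _.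
exact: mulr_ge0.
Qed.

Lemma ler_slack x y i : (forall j, x j <= y j) -> slack y i <= slack x i.
Proof.
move=> xy; rewrite lerD2l lerN2; apply: ler_sum => j _.
by apply: ler_wpM2r; [exact: ltW | exact: ler_qjac].
Qed.

(** Either there is slack at [mu] already, or a quadratic term supplies slack proportional to the
    smallest error of the component. *)
Lemma slack_lower i : exists i0 q, [/\ eqv i i0, 0 < q &
  forall x s, (forall j, 0 <= x j) -> (forall j, x j <= mu j) ->
    (forall j, eqv i j -> s <= mu j - x j) -> q * s <= slack x i0].
Proof.
have [[i0 ii0 sl]|[p [j [k [ip ij ik Bp]]]]] := slack_or_quadratic i.
  (* Dividing by [mu i0] works because [s <= mu i0 - x i0 <= mu i0]. *)
  exists i0, (slack mu i0 / mu i0); split=> // [|x s x0 xmu sx].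
    exact: divr_gt0.
  apply: le_trans (ler_slack _ xmu); rewrite -mulrA ler_piMr ?(ltW sl) //.
  rewrite mulrC ler_pdivrMr // mul1r; have := sx _ ii0; have := x0 i0; lra.
exists p, (2 * B p j k * d j); split=> // [|x s x0 xmu sx].
  by rewrite !mulr_gt0.
have pj : eqv p j by apply: eqv_trans ij; rewrite eqv_sym.
apply: le_trans (slack_ge_term k xmu pj); rewrite mulrAC ler_wpM2r ?(ltW (d_gt0 j)) //.
by rewrite ler_pM2l ?mulr_gt0 // sx.
Qed.

(** * Invariance under Newton steps *)

(** Strictness is asked on quadratic components, where slack may come from the errors alone;
    elsewhere a Newton step may hit [mu] exactly. *)
Definition newton_inv x :=
  [/\ forall i, 0 <= x i, forall i, x i <= mu i, forall i, x i <= qeval x i &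
      forall i, quadratic_scc i -> x i < mu i].

Lemma newton_inv_slack x : newton_inv x ->
  forall i, exists2 i0, eqv i i0 & 0 < slack x i0.
Proof.
move=> [x0 xmu xq xquad] i.
have [[i0 ii0 sl]|quad] := slack_or_quadratic i.
  by exists i0 => //; apply: lt_le_trans (ler_slack _ xmu).
have [p [j [k [ip ij ik Bp]]]] := quad.
exists p => //; have pj : eqv p j by apply: eqv_trans ij; rewrite eqv_sym.
apply: lt_le_trans (slack_ge_term k xmu pj); rewrite !mulr_gt0 // subr_gt0.
by apply: xquad; apply: quadratic_scc_eqv quad.
Qed.

(** The Jacobian being nonnegative, [max_principle] applies to the absolute values of [w]. This will
    give invertibility of [Id - f'(x)]. *)
Lemma newton_inv_kernel x w : newton_inv x ->
  (forall i, w i = \sum_j qjac x i j * w j) -> forall i, w i = 0.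
Proof.
move=> xinv wE i; apply/eqP; rewrite -normr_le0.
have [x0 xmu _ _] := xinv.
apply: (max_principle x0 xmu (newton_inv_slack xinv) (u := fun i => `|w i|)) => k.
rewrite {1}wE; apply: le_trans (ler_norm_sum _ _ _) _; apply: ler_sum => j _.
by rewrite normrM ger0_norm ?qjac_ge0.
Qed.

(** The linear equation solved by a Newton step, free of matrix inverses. *)
Definition newton_step x x' :=
  forall i, x' i - x i = \sum_j qjac x i j * (x' j - x j) + (qeval x i - x i).

Lemma newton_step_error x x' i : newton_step x x' ->
  mu i - x' i = \sum_j qjac x i j * (mu j - x' j) + qform (fun j => mu j - x j) i.
Proof.
move=> /(_ i); have := qeval_taylor x mu i; rewrite mu_fix.
have -> : \sum_j qjac x i j * (mu j - x' j) =
    \sum_j qjac x i j * (mu j - x j) - \sum_j qjac x i j * (x' j - x j).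
  by rewrite -sumrB; apply: eq_bigr => j _; ring.
lra.
Qed.

(** The maximum principle for [x - x'] and [x' - mu] gives the order; the Taylor remainder at [x]
    gives [x' <= qeval x']. *)
Lemma newton_step_inv x x' : newton_inv x -> newton_step x x' ->
  newton_inv x' /\ forall i, x i <= x' i.
Proof.
move=> xinv xx'; have [x0 xmu xq xquad] := xinv.
have sl := newton_inv_slack xinv.
have e0 k : 0 <= mu k - x k by rewrite subr_ge0.
have le_xx' i : x i <= x' i.
  rewrite -subr_le0; apply: (max_principle x0 xmu sl (u := fun i => x i - x' i)) => k.
  have := xx' k; have := xq k.
  have -> : \sum_j qjac x k j * (x j - x' j) = - \sum_j qjac x k j * (x' j - x j).
    by rewrite -sumrN; apply: eq_bigr => j _; ring.
  lra.
have x'mu i : x' i <= mu i.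
  rewrite -subr_le0; apply: (max_principle x0 xmu sl (u := fun i => x' i - mu i)) => k.
  have := newton_step_error k xx'; have := qform_ge0 k e0.
  have -> : \sum_j qjac x k j * (x' j - mu j) = - \sum_j qjac x k j * (mu j - x' j).
    by rewrite -sumrN; apply: eq_bigr => j _; ring.
  lra.
have e'0 k : 0 <= mu k - x' k by rewrite subr_ge0.
split=> //; split=> // [i|i|i quad].
- exact: le_trans (le_xx' i).
- rewrite (qeval_taylor x x'); have := xx' i.
  have : 0 <= qform (fun j => x' j - x j) i.
    by apply: qform_ge0 => j; rewrite subr_ge0.
  lra.
have [p [j [k [ip ij ik Bp]]]] := quad.
have quad_lt l : eqv i l -> 0 < mu l - x l.
  by move=> il; rewrite subr_gt0; apply: xquad; apply: quadratic_scc_eqv quad.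
(* A positive quadratic term makes the new error at [p] positive; it then propagates to [i] inside
   the component. *)
have e'p : 0 < mu p - x' p.
  rewrite (newton_step_error p xx'); apply: ltr_wpDl.
    by apply: sumr_ge0 => l _; rewrite mulr_ge0 ?qjac_ge0.
  have h1 : B p j k * ((mu j - x j) * (mu k - x k)) <=
     \sum_k B p j k * ((mu j - x j) * (mu k - x k)).
    apply: (@ler_sum_term _ _ xpredT
       (fun k => B p j k * ((mu j - x j) * (mu k - x k))) k) => // l _.
    by rewrite !mulr_ge0.
  apply: lt_le_trans (_ : 0 < \sum_k B p j k * ((mu j - x j) * (mu k - x k))) _.
    by apply: lt_le_trans h1; rewrite !mulr_gt0 ?quad_lt.
  apply: (@ler_sum_term _ _ xpredT
    (fun j => \sum_k B p j k * ((mu j - x j) * (mu k - x k))) j) => // l _.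
  by apply: sumr_ge0 => m _; rewrite !mulr_ge0.
rewrite -subr_gt0.
have := @scc_chain (fun k => mu k - x' k) 0 (mu p - x' p) p i (lexx _) (e'0 p) ip.
rewrite mulr0 !subr0 => chain; apply: lt_le_trans (_ : _ < _) (chain _ _) => //.
  by rewrite mulr_gt0 ?exprn_gt0.
move=> m l _ _ dml; rewrite subr0 (newton_step_error m xx').
have e'e r : mu r - x' r <= mu r - x r by rewrite lerD2l lerN2.
apply: le_trans (half_qjac_le m l x0 e'0 e'e (fun=> subrKC _ _)).
by apply: ler_wpM2r => //; have := dep_jac2 dml; lra.
Qed.

(** * Rates of convergence, level by level *)

Variable nu : nat -> I -> R.
Hypotheses (nu_inv : forall k, newton_inv (nu k))
           (nu_step : forall k, newton_step (nu k) (nu k.+1)).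

Lemma newton_error_decr k i : mu i - nu k.+1 i <= mu i - nu k i.
Proof. by rewrite lerD2l lerN2; case: (newton_step_inv (nu_inv k) (nu_step k)). Qed.

(* In [B(e, e)] the terms whose first index lies in the component are absorbed
   by the slack of [lam / 2 * d]; only errors of lower components remain. *)
Lemma scc_error_defect k i lam eta : 0 <= lam -> 0 <= eta ->
  (forall j, eqv i j -> mu j - nu k j <= lam * d j) ->
  (forall j, dep i j -> ~~ eqv i j -> mu j - nu k j <= eta) ->
  mu i - nu k.+1 i - lam / 2 * d i <=
  \sum_(j | eqv i j) qjac (nu k) i j * (mu j - nu k.+1 j - lam / 2 * d j)
  + (\sum_j qjac mu i j) * eta.
Proof.
move=> lam0 eta0 e_lam e_eta.
have [x0 xmu _ _] := nu_inv k.
set x := nu k in x0 xmu e_lam e_eta *.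
pose b j := \sum_l B i j l * (mu l - x l).
have b0 j : 0 <= b j by apply: sumr_ge0 => l _; rewrite mulr_ge0 // subr_ge0.
have e0 j : 0 <= mu j - x j by rewrite subr_ge0.
have := newton_step_error i (nu_step k); rewrite -/x.
have -> : qform (fun j => mu j - x j) i = \sum_j b j * (mu j - x j).
  apply: eq_bigr => j _; rewrite mulr_suml; apply: eq_bigr => l _; ring.
rewrite [X in _ = X + _](bigID (eqv i)) [X in _ = _ + X](bigID (eqv i)) /=.
have -> : \sum_(j | eqv i j) qjac x i j * (mu j - nu k.+1 j - lam / 2 * d j) =
  \sum_(j | eqv i j) qjac x i j * (mu j - nu k.+1 j) - lam / 2 * (d i - slack x i).
  rewrite /slack subKr mulr_sumr -sumrB; apply: eq_bigr => j _; ring.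
set S1 := \sum_(j | eqv i j) _ * _; set S2 := \sum_(j | eqv i j) b j * _.
set S3 := \sum_(j | ~~ eqv i j) _ * _; set S4 := \sum_(j | ~~ eqv i j) b j * _.
have S2_le : S2 <= lam / 2 * slack x i.
  apply: le_trans (_ : _ <= lam / 2 * _) ; last first.
    by apply: ler_wpM2l (slack_ge x i); rewrite divr_ge0.
  rewrite mulr_sumr; apply: ler_sum => j ij.
  apply: le_trans (_ : b j * (lam * d j) <= _); first by rewrite ler_wpM2l ?e_lam.
  by rewrite -/(b j); lra.
have S34_le : S3 + S4 <= (\sum_j qjac mu i j) * eta.
  rewrite mulr_suml [X in _ <= X](bigID (eqv i)) /= -[X in X <= _]add0r; apply: lerD.
    by apply: sumr_ge0 => j _; rewrite mulr_ge0 // qjac_ge0 // => l; rewrite ltW.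
  rewrite -big_split; apply: ler_sum => j ij /=.
  have [dij|/qjac_ndep ndij] := boolP (dep i j); last first.
    have bj : b j = 0.
      apply/eqP; rewrite -(inj_eq (mulfI (_ : 2 != 0))) // ?pnatr_eq0 //.
      by rewrite -qjac_sub !ndij ?mulr0 ?subrr // => l; rewrite ltW.
    rewrite !ndij ?bj ?mul0r ?addr0 // => l; exact: ltW.
  (* The new error is at most the old one, and [qjac x i j + b j] at most [qjac mu i j]. *)
  apply: le_trans (_ : (qjac x i j + b j) * (mu j - x j) <= _).
    rewrite [X in _ <= X]mulrDl lerD2r; apply: ler_wpM2l; first exact: qjac_ge0.
    exact: newton_error_decr.
  apply: ler_pM => //; first by rewrite addr_ge0 ?qjac_ge0.
    by have := qjac_sub x i j; rewrite -/(b j); have := b0 j; lra.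
  exact: e_eta.
rewrite -/x in S3 S4 S34_le *; lra.
Qed.

(** Induction on [k]. If the bound for [k.+1] already holds at step [k], monotonicity suffices.
    Otherwise all errors of the component, hence also the slack, are at least of order [rho ^+ k];
    the defect of order [rho ^+ (2 * k)] divided by it is again of order [rho ^+ k], and the factor
    [rho - 2^-1] closes the gap between halving and the rate [rho]. *)
Lemma scc_rate i rho W : 2^-1 <= rho -> rho <= 1 -> 0 <= W ->
  (forall p j k, eqv i p -> dep p j -> ~~ eqv p j ->
     mu j - nu k j <= W * (rho - 2^-1) * rho ^+ (2 * k)) ->
  exists2 K, 0 <= K & forall k p, eqv i p -> mu p - nu k p <= K * rho ^+ k * d p.
Proof.
move=> rho_ge rho_le1 W0 low.
have rho0 : 0 < rho by lra.
have rho2 : 0 <= rho - 2^-1 by lra.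
have [i0 [q [ii0 q0 slq]]] := slack_lower i.
pose G := \sum_p \sum_j qjac mu p j.
have [i2 ii2 dmin] := exists_argmin d (eqv_refl i).
have [i3 ii3 rmax] := exists_argmax (fun p => mu p / d p) (eqv_refl i).
(* If the bound for [k.+1] fails somewhere, all errors at step [k] are at least [c1 * lam]: [rho]
   comes from the failing bound, the power of [a] from [postfix_error_ratio]. *)
pose c1 := a ^+ #|I| * rho * d i2.
have c1_gt0 : 0 < c1 by rewrite !mulr_gt0 ?exprn_gt0.
have mu0 p : 0 <= mu p by rewrite ltW.
have Jmu0 p j : 0 <= qjac mu p j by exact: qjac_ge0.
have G0 : 0 <= G by apply: sumr_ge0 => p _; apply: sumr_ge0.
pose T := mp_const * (G * W) / (q * c1).
have T0 : 0 <= T.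
  exact: divr_ge0 (mulr_ge0 (ltW mp_const_gt0) (mulr_ge0 G0 W0)) (ltW (mulr_gt0 q0 c1_gt0)).
(* [mu i3 / d i3] starts the induction; [1] and [T] ensure [T / K <= K]. *)
pose K := 1 + mu i3 / d i3 + T.
have r30 : 0 <= mu i3 / d i3 by rewrite divr_ge0 ?mu0 ?(ltW (d_gt0 _)).
have K1 : 1 <= K by rewrite /K; lra.
have K0 : 0 < K by lra.
exists K; first exact: ltW.
elim=> [|k IHk] p ip.
  have [x0 _ _ _] := nu_inv 0; rewrite expr0 mulr1.
  apply: le_trans (_ : mu p <= _); first by rewrite gerBl.
  by rewrite -ler_pdivrMr //; apply: le_trans (rmax _ ip) _; rewrite /K; lra.
have [small|] := pselect (forall j, eqv i j -> mu j - nu k j <= K * rho ^+ k.+1 * d j).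
  by apply: le_trans (small _ ip); exact: newton_error_decr.
move=> /existsNP[i4 /not_implyP[ii4 /negP]]; rewrite -ltNge => big4.
have [x0 xmu xq _] := nu_inv k.
pose lam := K * rho ^+ k.
have lam0 : 0 < lam by rewrite mulr_gt0 ?exprn_gt0.
have low_e j : eqv i j -> c1 * lam <= mu j - nu k j.
  move=> ij; have i4j : eqv i4 j by apply: eqv_trans ij; rewrite eqv_sym.
  apply: le_trans (postfix_error_ratio x0 xmu xq i4j).
  rewrite /c1 -!mulrA ler_wpM2l ?exprn_ge0 ?(ltW a_gt0) //.
  apply: le_trans (ltW big4); rewrite exprS.
  rewrite (_ : K * (rho * rho ^+ k) * d i4 = rho * (d i4 * lam)); last by rewrite /lam; ring.
  by rewrite ler_pM2l // ler_pM2r // dmin.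
pose eta := W * (rho - 2^-1) * rho ^+ (2 * k).
have eta0 : 0 <= eta by rewrite !mulr_ge0 ?exprn_ge0 ?(ltW rho0).
(* Bounds the excess of the new error over half the old bound, with slack at least
   [q * (c1 * lam)]. *)
have := @scc_max_principle (nu k) (fun j => mu j - nu k.+1 j - lam / 2 * d j)
  (G * eta) (q * (c1 * lam)) i0 x0 xmu (mulr_ge0 G0 eta0) _ (slq _ _ x0 xmu low_e).
have i0p : eqv i0 p by apply: eqv_trans ip; rewrite eqv_sym.
move=> /(_ _ _ p i0p) /= mp.
have {mp} : mu p - nu k.+1 p - lam / 2 * d p <=
    mp_const * (G * eta) / (q * (c1 * lam)) * d p.
  apply: mp => [|j i0j]; first exact: mulr_gt0 q0 (mulr_gt0 c1_gt0 lam0).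
  have ij : eqv i j by apply: eqv_trans i0j.
  have Gj : \sum_l qjac mu j l <= G.
    apply: (@ler_sum_term _ _ xpredT (fun p => \sum_j qjac mu p j) j) => // l _.
    exact: sumr_ge0.
  have := ler_wpM2r eta0 Gj.
  have := @scc_error_defect k j lam eta (ltW lam0) eta0.
  move=> /(_ _ _)/le_trans h1 h2; apply: h1; last by rewrite lerD2l.
    by move=> l jl; apply: IHk; apply: eqv_trans jl.
  by move=> l djl njl; apply: low djl njl.
have -> : mp_const * (G * eta) / (q * (c1 * lam)) = T / K * (rho - 2^-1) * rho ^+ k.
  rewrite /T /eta /lam mulnC exprM; field.
  by rewrite !gt_eqF ?exprn_gt0 // ?mulr_gt0.
have TK : T / K <= K.
  by rewrite ler_pdivrMr //; apply: le_trans (_ : K <= _); [rewrite /K; lra | rewrite ler_peMl ?(ltW K0)].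
have : T / K * (rho - 2^-1) * rho ^+ k * d p <= K * (rho - 2^-1) * rho ^+ k * d p.
  by rewrite !ler_wpM2r ?exprn_ge0 // ltW.
rewrite exprS /lam; lra.
Qed.

(** Induction on the level: the rate [r t] of the lower components is [r t.+1 ^+ 2], the squared
    rate that [scc_rate] expects from them. *)
Lemma newton_level_rate (r : nat -> R) : r 0%N = 2^-1 ->
  (forall t, r t.+1 ^+ 2 = r t) -> (forall t, 2^-1 < r t.+1 <= 1) ->
  forall t, exists2 C, 0 <= C &
    forall i, (lev i <= t)%N -> forall k, mu i - nu k i <= C * r t ^+ k.
Proof.
move=> r0 rS r_bound.
have r_ge t : 2^-1 <= r t <= 1.
  case: t => [|t]; first by rewrite r0; apply/andP; split; lra.
  by have /andP[/ltW -> ->] := r_bound t.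
(* The level condition stands under the existential, so that finite choice gives a constant for
   every index. *)
suff H : forall t i, exists C, 0 <= C /\
    ((lev i <= t)%N -> forall k, mu i - nu k i <= C * r t ^+ k).
  move=> t; have [C CP] := fin_all_exists (H t).
  exists (\sum_i C i) => [|i levi k]; first by apply: sumr_ge0 => i _; case: (CP i).
  have [_ Ci] := CP i; apply: le_trans (Ci levi k) _; apply: ler_wpM2r.
    by rewrite exprn_ge0 //; have := r_ge t; lra.
  by apply: (@ler_sum_term _ _ xpredT C i) => // j _; case: (CP j).
have fromK t (b : bool) i : (exists2 K, 0 <= K & forall k p, eqv i p ->
      mu p - nu k p <= K * r t ^+ k * d p) ->
    exists C, 0 <= C /\ (b -> forall k, mu i - nu k i <= C * r t ^+ k).
  move=> [K K0 KP]; exists (K * d i); split=> [|_ k]; first by rewrite mulr_ge0 // ltW.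
  by rewrite mulrAC; apply: KP; apply: eqv_refl.
elim=> [|t IHt] i.
  have [|lev_gt] := leqP (lev i) 0; last by exists 0; split=> //; rewrite leqNgt lev_gt.
  move=> lev0; have levi : lev i = 0%N by apply/eqP; rewrite -leqn0.
  (* Nothing lies below level 0, hence [W = 0] and the rate 1/2. *)
  apply: fromK; apply: (@scc_rate i _ 0) => //.
  - by rewrite r0.
  - by rewrite r0; lra.
  - by move=> p j k ip dpj npj; have := lev_lt dpj npj; rewrite -(lev_eq ip) levi.
have [levi|lev_gt] := leqP (lev i) t.+1; last by exists 0; split=> //; rewrite leqNgt lev_gt.
have [C CP] := fin_all_exists IHt.
have /andP[rt1 rt2] := r_bound t.
have rho2 : 0 < r t.+1 - 2^-1 by lra.
have C0 : 0 <= \sum_i C i by apply: sumr_ge0 => j _; case: (CP j).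
apply: fromK; apply: (@scc_rate i _ ((\sum_i C i) / (r t.+1 - 2^-1))) => //.
- exact: ltW.
- by rewrite divr_ge0 // ltW.
move=> p j k ip dpj npj; rewrite divfK ?gt_eqF // exprM rS.
have [_ Cj] := CP j; apply: le_trans (Cj _ k) _.
  by rewrite -ltnS; apply: (leq_trans (lev_lt dpj npj)); rewrite -(lev_eq ip).
apply: ler_wpM2r; first by rewrite exprn_ge0 //; have := r_ge t; lra.
by apply: (@ler_sum_term _ _ xpredT C j) => // l _; case: (CP l).
Qed.

End QuadraticSystem.

(** * The least fixed point as a limit *)

Section VectorSequences.
Local Open Scope classical_set_scope.

Lemma cvg_sumr (R : realType) (T I : Type) (F : set_system T) {FF : Filter F}
    (s : seq I) (P : pred I) (f : I -> T -> R) (l : I -> R) :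
  (forall i, f i t @[t --> F] --> l i) ->
  \sum_(i <- s | P i) f i t @[t --> F] --> \sum_(i <- s | P i) l i.
Proof.
move=> fl; elim: s => [|i s IHs].
  rewrite big_nil; under eq_fun do rewrite big_nil; exact: cvg_cst.
rewrite big_cons; under eq_fun do rewrite big_cons.
by case: ifP => // _; apply: cvgD.
Qed.

(** Compactness of the cube gives a cluster point; [k <= s k] sends [s] to infinity, which is enough
    to pass to limits. *)
Lemma bounded_vector_subsequence (R : realType) (n : nat) (u : nat -> 'I_n -> R)
    (b : R) :
  (forall k i, `|u k i| <= b) ->
  exists (l : 'I_n -> R) (s : nat -> nat),
    (forall k, (k <= s k)%N) /\ forall i, u (s k) i @[k --> \oo] --> l i.
Proof.
move=> ub.
have cb := @rV_compact R n (fun=> `[- b, b]) (fun=> @segment_compact R _ _).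
pose v k : 'rV[R]_n := \row_i u k i.
have [|p [_ vp]] := cb (v k @[k --> \oo]) _.
  by exists 0%N => // k _ i /=; rewrite mxE in_itv /= -ler_norml.
have sub N : exists m, (N <= m)%N /\ forall i, `|p 0 i - u m i| < N.+1%:R^-1.
  have /= [] := vp (v @` [set m | (N <= m)%N]) (ball p N.+1%:R^-1).
  - by exists N => // m /= Nm; exists m.
  - by apply: nbhsx_ballx; rewrite invr_gt0.
  move=> _ [[m /= Nm <-] [_ pm]]; exists m; split=> // i.
  by have := pm 0 i; rewrite mxE.
have [s sP] := choice sub.
exists (fun i => p 0 i), s; split=> [k|i]; first by case: (sP k).
apply/cvgrPdist_lt => e e0; near=> k.
have [_ /(_ i)/lt_trans->//] := sP k.
near: k; have := @cvgr_lt _ _ _ _ _ _ (@cvg_harmonic R) _ e0.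
exact.
Unshelve. all: end_near. Qed.

End VectorSequences.

(** * Damped Kleene iteration and its limit *)

Section KleeneLimit.
Local Open Scope classical_set_scope.
Variables (R : realType) (n : nat).
Variables (c : 'I_n -> R) (L : 'I_n -> 'I_n -> R) (B : 'I_n -> 'I_n -> 'I_n -> R).
Hypotheses (c_ge0 : forall i, 0 <= c i) (L_ge0 : forall i j, 0 <= L i j).
Hypotheses (B_ge0 : forall i j k, 0 <= B i j k).
Hypothesis (B_sym : forall i j k, B i j k = B i k j).

Local Notation qeval := (qeval c L B).
Local Notation qjac := (qjac L B).

Lemma cvg_qeval (T : Type) (F : set_system T) {FF : Filter F}
    (u : T -> 'I_n -> R) (l : 'I_n -> R) i :
  (forall j, u t j @[t --> F] --> l j) -> qeval (u t) i @[t --> F] --> qeval l i.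
Proof.
move=> ul; apply: cvgD; first apply: cvgD.
- exact: cvg_cst.
- by apply: cvg_sumr => j; apply: cvgM => //; exact: cvg_cst.
apply: cvg_sumr => j; apply: cvg_sumr => k; apply: cvgM; first exact: cvg_cst.
exact: cvgM.
Qed.

Lemma cvg_qjac (T : Type) (F : set_system T) {FF : Filter F}
    (u : T -> 'I_n -> R) (l : 'I_n -> R) i j :
  (forall j, u t j @[t --> F] --> l j) -> qjac (u t) i j @[t --> F] --> qjac l i j.
Proof.
move=> ul; apply: cvgD; first exact: cvg_cst.
apply: cvgM; first exact: cvg_cst.
by apply: cvg_sumr => k; apply: cvgM => //; exact: cvg_cst.
Qed.

(* Damping the Kleene iteration keeps every iterate strictly below [mu]: the
   plain iteration may reach [mu] in some coordinates. *)
Fixpoint damped_kleene (k : nat) : 'I_n -> R :=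
  if k is k'.+1 then fun i => (1 - k'.+2%:R^-1) * qeval (damped_kleene k') i
  else fun=> 0.
Local Notation y := damped_kleene.

Let damp_ge0 k : 0 <= 1 - k.+1%:R^-1 :> R.
Proof. by rewrite subr_ge0 invf_le1 // ler1n. Qed.

Lemma damped_kleene_ge0 k i : 0 <= y k i.
Proof. by elim: k i => //= k IHk i; rewrite mulr_ge0 // qeval_ge0. Qed.

Lemma damped_kleene_le_qeval k i : y k.+1 i <= qeval (y k) i.
Proof.
apply: ler_piMl; last by rewrite gerBl invr_ge0.
by apply: qeval_ge0 => // j; exact: damped_kleene_ge0.
Qed.

Lemma damped_kleene_le_S k i : y k i <= y k.+1 i.
Proof.
elim: k i => [|k IHk] i; first exact: damped_kleene_ge0.
rewrite [X in X <= _]/= [X in _ <= X]/=; apply: ler_pM => //.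
- by apply: qeval_ge0 => // j; exact: damped_kleene_ge0.
- by rewrite lerD2l lerN2 lef_pV2 ?posrE // ler_nat.
by apply: ler_qeval => // j; exact: damped_kleene_ge0.
Qed.

Lemma damped_kleene_postfix k i : y k i <= qeval (y k) i.
Proof. exact: le_trans (damped_kleene_le_S k i) (damped_kleene_le_qeval k i). Qed.

Lemma damped_kleene_bound z k i :
  (forall i, 0 <= z i) -> (forall i, qeval z i = z i) ->
  y k i <= (1 - k.+1%:R^-1) * z i.
Proof.
move=> z0 zfix; elim: k i => [|k IHk] i; first by rewrite invr1 subrr mul0r.
apply: ler_wpM2l => //; rewrite -[z i]zfix; apply: ler_qeval => // j.
  exact: damped_kleene_ge0.
apply: le_trans (IHk j) _.
by rewrite ler_piMl // gerBl invr_ge0.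
Qed.

Lemma damped_kleene_le_fix z k i :
  (forall i, 0 <= z i) -> (forall i, qeval z i = z i) -> y k i <= z i.
Proof.
move=> z0 zfix; apply: le_trans (damped_kleene_bound k i z0 zfix) _.
by rewrite ler_piMl // gerBl invr_ge0.
Qed.

Lemma damped_kleene_lt_fix z k i :
  (forall i, 0 < z i) -> (forall i, qeval z i = z i) -> y k i < z i.
Proof.
move=> z0 zfix.
apply: le_lt_trans (damped_kleene_bound k i (fun i => ltW (z0 i)) zfix) _.
by rewrite gtr_pMl // gtrBl invr_gt0.
Qed.

(** The iterates increase below [z]; the damping factors tend to 1, so by continuity the limit is a
    fixed point. *)
Lemma damped_kleene_cvg (z : 'I_n -> R) :
  (forall i, 0 <= z i) -> (forall i, qeval z i = z i) ->
  exists mu, [/\ forall i, 0 <= mu i, forall i, qeval mu i = mu i &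
    forall i, y k i @[k --> \oo] --> mu i].
Proof.
move=> z0 zfix; pose mu i : R := limn (fun k => y k i).
have ymu i : y k i @[k --> \oo] --> mu i.
  apply: nondecreasing_is_cvgn.
    by apply/nondecreasing_seqP => k; exact: damped_kleene_le_S.
  by exists (z i) => _ [k _ <-]; exact: damped_kleene_le_fix.
exists mu; split=> // i.
  apply: (cvgr_to_ge (ymu i)); apply: nearW => k; exact: damped_kleene_ge0.
have := ymu i; rewrite -cvg_shiftS => /cvg_lim <- //.
apply/esym/cvg_lim => //.
rewrite -[X in _ --> X]mul1r -[X in X * _]subr0; apply: cvgM; last exact: cvg_qeval.
apply: cvgB; first exact: cvg_cst.
by have := @cvg_harmonic R; rewrite -cvg_shiftS.
Qed.

Variable dep : rel 'I_n.
Let eqv i j := connect dep i j && connect dep j i.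

(* The errors of the damped iteration satisfy [qjac y e <= e] with comparable
   entries in each component; any limit of their normalisations will do. *)
Lemma exists_subinvariant (mu : 'I_n -> R) (a : R) :
  (forall i, 0 < mu i) -> (forall i, qeval mu i = mu i) ->
  (forall i, y k i @[k --> \oo] --> mu i) -> 0 < a -> a <= 1 ->
  (forall i j, dep i j -> 2 * a <= qjac mu i j) ->
  exists d : 'I_n -> R, (forall i, 0 < d i) /\
    forall i, \sum_(j | eqv i j) qjac mu i j * d j <= d i.
Proof.
move=> mu0 mufix ymu a0 a1 depJ.
have erefl i : eqv i i by rewrite /eqv connect0.
have eqvE i j : eqv i j -> eqv i =1 eqv j.
  move=> /andP[ij ji] k; rewrite /eqv; apply/andP/andP => -[h1 h2]; split.
  - exact: connect_trans ji h1.
  - exact: connect_trans h2 ij.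
  - exact: connect_trans ij h1.
  - exact: connect_trans h2 ji.
pose e k i := mu i - y k i.
have e0 k i : 0 < e k i by rewrite subr_gt0; exact: damped_kleene_lt_fix.
(* Each component is normalised by its own sum, since errors of different components may shrink at
   different speeds. *)
pose N k i := \sum_(j | eqv i j) e k j.
have eN k i : e k i <= N k i by apply: (ler_sum_term (erefl i)) => j _; rewrite ltW.
have N0 k i : 0 < N k i by apply: lt_le_trans (eN k i).
pose u k i := e k i / N k i.
have u1 k i : u k i <= 1 by rewrite ler_pdivrMr // mul1r.
(* Comparable entries keep at least this share of the sum, so no entry of the limit vanishes. *)
pose b := a ^+ #|'I_n| / n%:R.
have u_ge k i : b <= u k i.
  have n0 : (0 < n)%N by apply: leq_trans (ltn_ord i).
  rewrite ler_pdivlMr // /b mulrAC ler_pdivrMr ?ltr0n //.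
  have -> : n%:R = \sum_(j < n) 1 :> R by rewrite sumr_const card_ord.
  rewrite !mulr_sumr.
  rewrite [leRHS](bigID (eqv i)) /= -[leLHS]addr0; apply: lerD; last first.
    by apply: sumr_ge0 => j _; rewrite mulr1 ltW.
  apply: ler_sum => j ij; rewrite mulr1.
  apply: (@postfix_error_ratio R 'I_n c L B L_ge0 B_ge0 B_sym dep mu a) => //.
  - exact: damped_kleene_ge0.
  - by move=> l; rewrite ltW // damped_kleene_lt_fix.
  - exact: damped_kleene_postfix.
  - by move: ij; rewrite /eqv andbC.
have u_sub k i : \sum_(j | eqv i j) qjac (y k) i j * u k j <= u k i.
  rewrite /u ler_pdivlMr // mulr_suml.
  apply: le_trans (_ : \sum_(j | eqv i j) qjac (y k) i j * e k j <= _).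
    apply: ler_sum => j ij.
    have -> : N k i = N k j by apply: eq_bigl; exact: eqvE.
    by rewrite -mulrA divfK // gt_eqF.
  have := @postfix_error R 'I_n c L B B_sym mu mufix (y k) i (damped_kleene_postfix k).
  apply: le_trans; rewrite [X in _ <= X + _](bigID (eqv i)) /= -addrA lerDl.
  rewrite addr_ge0 ?qform_ge0 // => [|j]; last exact: ltW (e0 k j).
  apply: sumr_ge0 => j _; rewrite mulr_ge0 ?qjac_ge0 ?(ltW (e0 k j)) //.
  exact: damped_kleene_ge0.
have [|d [s [sk ud]]] := @bounded_vector_subsequence R n u 1.
  by move=> k i; rewrite ger0_norm // divr_ge0 // ltW.
exists d; split=> i.
  have b0 : 0 < b.
    by rewrite divr_gt0 ?exprn_gt0 // ltr0n (leq_trans _ (ltn_ord i)).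
  apply: lt_le_trans b0 _; apply: (cvgr_to_ge (ud i)); exact: nearW.
have smu j : y (s k) j @[k --> \oo] --> mu j.
  apply: (squeeze_cvgr (f := y ^~ j) (h := fun=> mu j)) => //; last exact: cvg_cst.
  apply: nearW => k; rewrite (ltW (damped_kleene_lt_fix _ _ mu0 mufix)) andbT.
  have /nondecreasing_seqP : forall k, y k j <= y k.+1 j by move=> ?; exact: damped_kleene_le_S.
  exact.
have lim_sum : \sum_(j | eqv i j) qjac (y (s k)) i j * u (s k) j @[k --> \oo] -->
    \sum_(j | eqv i j) qjac mu i j * d j.
  by apply: cvg_sumr => j; apply: cvgM => //; exact: cvg_qjac.
by apply: (ler_cvg_to lim_sum (ud i)); exact: nearW.
Qed.

End KleeneLimit.

(** * Second-order expansion of quadratic polynomials *)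

Lemma multinom_deg_le2 (n : nat) (m : multinom n) : (mdeg m <= 2)%N ->
  m = mnm0 \/ (exists i, m = mnm1 i) \/ (exists i j, m = mnm_add (mnm1 i) (mnm1 j)).
Proof.
have deg1 (m' : multinom n) : (mdeg m' <= 1)%N -> m' = mnm0 \/ exists i, m' = mnm1 i.
  case E: (mdeg m') => [|[|//]] _.
    by left; apply/eqP; rewrite -mdeg_eq0 E.
  by right; have /mdeg1P[i /eqP ->] : mdeg m' == 1%N by [rewrite E]; exists i.
move=> m2; have [->|m0] := eqVneq m mnm0; first by left.
right; have [i mi] : exists i, (0 < m i)%N.
  apply/existsP; apply: contraR m0; rewrite negb_exists => /forallP m0.
  by apply/eqP/mnmP => i; rewrite mnmE; apply/eqP; rewrite -leqn0 leqNgt.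
have le1 : lem (mnm1 i) m.
  by apply/mnm_lepP => j; rewrite mnm1E; case: eqP => // <-.
have mE := submK le1; set m' := mnm_sub m (mnm1 i) in mE.
have [] := deg1 m'.
- by move: m2; rewrite -mE mdegD mdeg1 addn1.
- by move=> m'0; left; exists i; rewrite -mE m'0 add0m.
by move=> [j m'j]; right; exists j, i; rewrite -mE m'j.
Qed.

Section SecondOrderExpansion.
Variables (R : realFieldType) (n : nat).
Implicit Types (p q : mpoly n R) (v : 'I_n -> R).

Definition const_coef p : R := mcoeff mnm0 p.
Definition lin_coef p j : R := const_coef (mderiv j p).
(** Half a second derivative at 0: the coefficient of a mixed monomial is shared equally between
    [j, k] and [k, j]. *)
Definition quad_coef p j k : R := const_coef (mderiv k (mderiv j p)) / 2.

(** Closed under linear combinations, so that monomials suffice; the derivatives are included for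
    the sake of the Jacobian. *)
Definition second_order p : Prop := forall v,
  (meval v p = const_coef p + \sum_j lin_coef p j * v j +
     \sum_j \sum_k quad_coef p j k * (v j * v k)) /\
  forall j, meval v (mderiv j p) = lin_coef p j + 2 * \sum_k quad_coef p j k * v k.

Lemma second_order0 : second_order 0.
Proof.
have z j k : quad_coef 0 j k = 0 by rewrite /quad_coef /const_coef !mderiv0 mcoeff0 mul0r.
have l j : lin_coef 0 j = 0 by rewrite /lin_coef /const_coef !mderiv0 mcoeff0.
move=> v; split=> [|j].
  rewrite meval0 /const_coef mcoeff0 !big1 ?addr0 // => j _; rewrite ?l ?mul0r //.
  by rewrite big1 // => k _; rewrite z mul0r.
by rewrite mderiv0 meval0 l big1 ?mulr0 ?addr0 // => k _; rewrite z mul0r.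
Qed.

Lemma second_orderD p q : second_order p -> second_order q -> second_order (p + q).
Proof.
move=> sp sq v; have [pE dpE] := sp v; have [qE dqE] := sq v.
have zD j k : quad_coef (p + q) j k = quad_coef p j k + quad_coef q j k.
  by rewrite /quad_coef /const_coef !mderivD mcoeffD mulrDl.
have lD j : lin_coef (p + q) j = lin_coef p j + lin_coef q j.
  by rewrite /lin_coef /const_coef mderivD mcoeffD.
split=> [|j].
  rewrite mevalD pE qE /const_coef mcoeffD.
  have -> : \sum_j lin_coef (p + q) j * v j =
      \sum_j lin_coef p j * v j + \sum_j lin_coef q j * v j.
    by rewrite -big_split; apply: eq_bigr => j _; rewrite lD mulrDl.
  have -> : \sum_j \sum_k quad_coef (p + q) j k * (v j * v k) =
      \sum_j \sum_k quad_coef p j k * (v j * v k) +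
      \sum_j \sum_k quad_coef q j k * (v j * v k).
    rewrite -big_split; apply: eq_bigr => j _; rewrite -big_split.
    by apply: eq_bigr => k _; rewrite zD mulrDl.
  ring.
rewrite mderivD mevalD dpE dqE lD.
have -> : \sum_k quad_coef (p + q) j k * v k =
    \sum_k quad_coef p j k * v k + \sum_k quad_coef q j k * v k.
  by rewrite -big_split; apply: eq_bigr => k _; rewrite zD mulrDl.
ring.
Qed.

Lemma second_orderZ (a : R) p : second_order p -> second_order (a *: p).
Proof.
move=> sp v; have [pE dpE] := sp v.
have zZ j k : quad_coef (a *: p) j k = a * quad_coef p j k.
  by rewrite /quad_coef /const_coef !mderivZ mcoeffZ mulrA.
have lZ j : lin_coef (a *: p) j = a * lin_coef p j.
  by rewrite /lin_coef /const_coef mderivZ mcoeffZ.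
split=> [|j].
  rewrite mevalZ pE /const_coef mcoeffZ !mulrDr !mulr_sumr.
  congr (_ + _ + _); apply: eq_bigr => j _; first by rewrite lZ mulrA.
  by rewrite mulr_sumr; apply: eq_bigr => k _; rewrite zZ -[RHS]mulrA.
rewrite mderivZ mevalZ dpE lZ.
have -> : \sum_k quad_coef (a *: p) j k * v k = a * \sum_k quad_coef p j k * v k.
  by rewrite mulr_sumr; apply: eq_bigr => k _; rewrite zZ -mulrA.
ring.
Qed.

Let mderivX1 j i : mderiv j (mpolyX R (mnm1 i)) = mpolyC n (i == j)%:R.
Proof.
rewrite mderivX mnm1E; case: eqP => [->|_]; last by rewrite scale0r mpolyC0.
have -> : mnm_sub (mnm1 j) (mnm1 j) = mnm0 :> multinom n.
  by apply/mnmP => k; rewrite !mnmE subnn.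
by rewrite scale1r mpolyX0 mpolyC1.
Qed.

Let sum_delta i (F : 'I_n -> R) : \sum_j (i == j)%:R * F j = F i.
Proof.
rewrite (bigD1 i) //= eqxx mul1r big1 ?addr0 // => j ji.
by rewrite eq_sym (negbTE ji) mul0r.
Qed.

Lemma second_order_monomial m : (mdeg m <= 2)%N -> second_order (mpolyX R m).
Proof.
case/multinom_deg_le2 => [->|[[i ->]|[i [i' ->]]]] v.
- have l j : lin_coef (mpolyX R mnm0) j = 0.
    by rewrite /lin_coef /const_coef mpolyX0 -mpolyC1 mderivC mcoeff0.
  have z j k : quad_coef (mpolyX R mnm0) j k = 0.
    by rewrite /quad_coef /const_coef mpolyX0 -mpolyC1 !mderivC ?mderiv0 mcoeff0 mul0r.
  split=> [|j].
    rewrite !big1 => [|j _|j _]; rewrite ?l ?mul0r //; last first.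
      by rewrite big1 // => k _; rewrite z mul0r.
    by rewrite !addr0 mpolyX0 meval1 /const_coef mcoeff1 eqxx.
  rewrite big1 => [|k _]; last by rewrite z mul0r.
  by rewrite l mulr0 addr0 mpolyX0 -mpolyC1 mderivC meval0.
- have l j : lin_coef (mpolyX R (mnm1 i)) j = (i == j)%:R.
    by rewrite /lin_coef /const_coef mderivX1 mcoeffC eqxx mulr1.
  have z j k : quad_coef (mpolyX R (mnm1 i)) j k = 0.
    by rewrite /quad_coef /const_coef mderivX1 mderivC mcoeff0 mul0r.
  split=> [|j].
    rewrite mevalXU [X in _ + X]big1 => [|j _]; last first.
      by rewrite big1 // => k _; rewrite z mul0r.
    rewrite addr0; under eq_bigr => j _ do rewrite l.
    rewrite sum_delta /const_coef mcoeffX -mdeg_eq0 mdeg1 /= add0r //.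
  rewrite big1 => [|k _]; last by rewrite z mul0r.
  by rewrite l mulr0 addr0 mderivX1 mevalC.
have dE j : mderiv j (mpolyX R (mnm_add (mnm1 i) (mnm1 i'))) =
    mpolyC n (i == j)%:R * mpolyX R (mnm1 i') + mpolyX R (mnm1 i) * mpolyC n (i' == j)%:R.
  by rewrite mpolyXD mderivM !mderivX1.
have cX k : mcoeff mnm0 (mpolyX R (mnm1 k)) = 0 :> R.
  by rewrite mcoeffX -mdeg_eq0 mdeg1.
have l j : lin_coef (mpolyX R (mnm_add (mnm1 i) (mnm1 i'))) j = 0.
  rewrite /lin_coef /const_coef dE mcoeffD mcoeffCM mulrC [mpolyX _ _ * _]mulrC mcoeffCM.
  by rewrite !cX mulr0 mul0r addr0.
(* The case [i = i'] is included: the two products then coincide and the halving cancels. *)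
have z j k : quad_coef (mpolyX R (mnm_add (mnm1 i) (mnm1 i'))) j k =
   ((i == j)%:R * (i' == k)%:R + (i == k)%:R * (i' == j)%:R) / 2.
  rewrite /quad_coef /const_coef dE mderivD !mderivM !mderivX1 !mderivC mul0r mulr0.
  by rewrite add0r addr0 -!mpolyCM -mpolyCD mcoeffC eqxx mulr1.
split=> [|j].
  have -> : \sum_j lin_coef (mpolyX R (mnm_add (mnm1 i) (mnm1 i'))) j * v j = 0.
    by apply: big1 => j _; rewrite l mul0r.
  rewrite {1}mpolyXD mevalM !mevalXU /const_coef mcoeffX -mdeg_eq0 mdegD !mdeg1 /= add0r add0r.
  transitivity (\sum_j ((i == j)%:R * (v i' * v j / 2) + (i' == j)%:R * (v i * v j / 2))).
    by rewrite big_split /= !sum_delta; field.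
  apply: eq_bigr => j _.
  transitivity (\sum_k ((i' == k)%:R * ((i == j)%:R * (v j * v k) / 2) +
      (i == k)%:R * ((i' == j)%:R * (v j * v k) / 2))).
    by rewrite big_split /= !sum_delta; field.
  by apply: eq_bigr => k _; rewrite z; field.
rewrite dE mevalD !mevalM !mevalC !mevalXU l add0r.
transitivity (2 * \sum_k ((i' == k)%:R * ((i == j)%:R * v k / 2) +
      (i == k)%:R * ((i' == j)%:R * v k / 2))).
  by rewrite big_split /= !sum_delta; field.
by congr (2 * _); apply: eq_bigr => k _; rewrite z; field.
Qed.

Lemma second_order_deg_le2 p :
  (forall m : multinom n, m \in msupp p -> (mdeg m <= 2)%N) -> second_order p.
Proof.
move=> deg_p; rewrite [p]mpolyE big_seq.
apply: (big_ind second_order); [exact: second_order0 | exact: second_orderD |].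
by move=> m /deg_p m2; apply: second_orderZ; apply: second_order_monomial.
Qed.

End SecondOrderExpansion.

(** * Levels of the SCCs *)

Section SccLevels.
Variables (R : realType) (n : nat) (f : polysys R n).

Definition scc_of (i : 'I_n) : {set 'I_n} :=
  [set j in [set: 'I_n] | mutually_dependent f i j].

Lemma scc_of_sccs i : scc_of i \in sccs f.
Proof. by apply/imsetP; exists i; rewrite ?inE. Qed.

Lemma mem_scc_of i j : (j \in scc_of i) = mutually_dependent f i j.
Proof. by rewrite !inE. Qed.

Lemma mutually_dependent_refl i : mutually_dependent f i i.
Proof. by rewrite /mutually_dependent connect0. Qed.

Lemma scc_of_eq i j : mutually_dependent f i j -> scc_of i = scc_of j.
Proof.
by apply: sccs_eq; rewrite ?scc_of_sccs // mem_scc_of mutually_dependent_refl.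
Qed.

Lemma scc_edge_dep i j : depends_directly f i j -> ~~ mutually_dependent f i j ->
  scc_edge f (scc_of j) (scc_of i).
Proof.
move=> dij nij; rewrite /scc_edge !scc_of_sccs /=; apply/andP; split.
  apply: contra nij => /eqP E.
  by rewrite -mem_scc_of -E mem_scc_of mutually_dependent_refl.
apply/exists_inP; exists i; first by rewrite mem_scc_of mutually_dependent_refl.
by apply/exists_inP; exists j; rewrite ?mem_scc_of ?mutually_dependent_refl.
Qed.

(** A path that does not end in a sink can be extended, but no path has more than [n] edges. *)
Lemma scc_path_to_sink S : S \in sccs f ->
  exists p, path (scc_edge f) S p && scc_sink f (last S p).
Proof.
move=> sS.
suff H m : (exists p, path (scc_edge f) S p && scc_sink f (last S p)) \/
    exists p, path (scc_edge f) S p /\ size p = m.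
  have [//|[p [Sp sp]]] := H n.+1.
  by have := scc_path_size Sp; rewrite sp ltnn.
elim: m => [|m [|[p [Sp sp]]]]; [by right; exists [::] | by left |].
have [sink|] := boolP (scc_sink f (last S p)).
  by left; exists p; rewrite Sp.
have lastS : last S p \in sccs f.
  case/lastP: p Sp {sp} => // p T; rewrite rcons_path last_rcons.
  by case/andP => _ /and4P[].
rewrite /scc_sink lastS /= negb_forall => /existsP[T]; rewrite negbK => ST.
by right; exists (rcons p T); rewrite rcons_path Sp ST size_rcons sp.
Qed.

(** [S] can be put in front of a longest path from [T] to a sink. *)
Lemma depth_edge S T : scc_edge f S T -> (depth f T < depth f S)%N.
Proof.
move=> ST; have [sS sT _ _] := and4P ST.
have [p0 /andP[Tp0 sink0]] := scc_path_to_sink sT.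
pose P S (l : 'I_n.+1) := [exists p : l.-tuple {set 'I_n},
  path (scc_edge f) S p && scc_sink f (last S p)].
have l0 : (size p0 < n.+1)%N by rewrite ltnS; exact: scc_path_size Tp0.
have [|l /existsP[p /andP[Tp sink]] E] := @eq_bigmax_cond _ (P T) (@nat_of_ord _).
  apply/card_gt0P; exists (Ordinal l0); rewrite unfold_in.
  by apply/existsP; exists (in_tuple p0); rewrite Tp0.
rewrite /depth E.
have STp : path (scc_edge f) S (T :: p) by rewrite /= ST.
have l1 : (l.+1 < n.+1)%N by rewrite ltnS; have := scc_path_size STp; rewrite /= size_tuple.
apply: (@leq_bigmax_cond _ (P S) (@nat_of_ord _) (Ordinal l1)).
by apply/existsP; exists [tuple of T :: p]; rewrite /= ST Tp.
Qed.

(** Depth grows towards the components that others rely on; its complement grows the other way and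
    never exceeds [height f]. *)
Definition level i := (height f - depth f (scc_of i))%N.

Lemma level_eq i j : mutually_dependent f i j -> level i = level j.
Proof. by move=> ij; rewrite /level (scc_of_eq ij). Qed.

Lemma level_lt i j : depends_directly f i j -> ~~ mutually_dependent f i j ->
  (level j < level i)%N.
Proof.
move=> dij nij; have lt_ij := depth_edge (scc_edge_dep dij nij).
apply: ltn_sub2l => //; apply: leq_trans lt_ij _.
exact: (@leq_bigmax_cond _ _ (depth f) _ (scc_of_sccs j)).
Qed.

End SccLevels.

(** * Convergence of the Newton sequence *)

Section Rates.
Variable R : realType.

(** In closed form [2^(-1/2^t)]. *)
Definition newton_rate (t : nat) : R := iter t Num.sqrt 2^-1.

Lemma newton_rate_gt0 t : 0 < newton_rate t.
Proof. by elim: t => [|t IHt]; rewrite /= ?invr_gt0 // sqrtr_gt0. Qed.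

Lemma newton_rateS t : newton_rate t.+1 ^+ 2 = newton_rate t.
Proof. by rewrite /= sqr_sqrtr // ltW // newton_rate_gt0. Qed.

Lemma newton_rate_pow t : newton_rate t ^+ (2 ^ t) = 2^-1.
Proof.
by elim: t => [|t IHt]; [rewrite expr1 | rewrite expnS exprM newton_rateS].
Qed.

Lemma newton_rate_bound t : 2^-1 < newton_rate t.+1 <= 1.
Proof.
have half : 0 < 2^-1 :> R by rewrite invr_gt0.
have : 2^-1 <= newton_rate t <= 1.
  elim: t => [|t /andP[IH1 IH2]]; first by rewrite lexx invf_le1 // ler1n.
  have := newton_rateS t; have := newton_rate_gt0 t.+1; nra.
have := newton_rateS t; have := newton_rate_gt0 t.+1; nra.
Qed.

Lemma newton_rate_lt1 t : newton_rate t < 1.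
Proof.
elim: t => [|t IHt]; first by rewrite invf_lt1 // ltr1n.
have := newton_rateS t; have := newton_rate_gt0 t.+1; nra.
Qed.

End Rates.

Lemma exists_lower_bound (R : realFieldType) (I : finType) (P : pred I) (F : I -> R) :
  (forall i, P i -> 0 < F i) ->
  exists a, [/\ 0 < a, a <= 1 & forall i, P i -> a <= F i].
Proof.
move=> F0; case: (pickP P) => [i0 Pi0|P0]; last first.
  by exists 1; split=> // i; rewrite P0.
have [i1 Pi1 i1min] := exists_argmin F Pi0.
exists (Num.min 1 (F i1)); split=> [||i Pi]; rewrite ?lt_min ?ltr01 ?F0 //.
  by rewrite ge_min lexx.
by rewrite ge_min i1min // orbT.
Qed.

Lemma pow_lt_eventually (R : realType) (C r e : R) : 0 <= r -> r < 1 -> 0 < e ->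
  exists k, C * r ^+ k <= e.
Proof.
move=> r0 r1 e0.
have h : (C * r ^+ k @[k --> \oo] --> C * 0)%classic.
  by apply: cvgM; [exact: cvg_cst | apply: cvg_expr; rewrite ger0_norm].
rewrite mulr0 in h.
by have /cvgr_le/(_ _ e0)[k _ /(_ k (leqnn k))] := h; exists k.
Qed.

Lemma cvg_colvec (R : realType) (n : nat) (u : nat -> 'cV[R]_n) (l : 'cV[R]_n)
    (v : nat -> R) :
  (forall k i, `|u k i 0 - l i 0| <= v k) -> (v k @[k --> \oo] --> 0)%classic ->
  (u k @[k --> \oo] --> l)%classic.
Proof.
move=> uv v0; apply/cvg_ballP => e e0.
have /cvgr_lt/(_ _ e0)[N _ NP] := v0; exists N => // k Nk; split=> // i j.
rewrite /ball /= (ord1 j) distrC; apply: le_lt_trans (uv k i) _; exact: NP.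
Qed.

(** * Monotone systems as quadratic maps *)

Section QuadraticMSP.
Variables (R : realType) (n : nat) (f : polysys R n).
Hypotheses (f_msp : monotone_system f) (f_quadratic : quadratic f).

Let c i := const_coef (f i).
Let L i j := lin_coef (f i) j.
Let B i j k := quad_coef (f i) j k.

Let mderiv_coef_ge0 i j m : 0 <= mcoeff m (mderiv j (f i)).
Proof. by rewrite mcoeff_mderiv mulrn_wge0. Qed.

Lemma msp_const_ge0 i : 0 <= c i. Proof. exact: f_msp. Qed.

Lemma msp_lin_ge0 i j : 0 <= L i j. Proof. exact: mderiv_coef_ge0. Qed.

Lemma msp_quad_ge0 i j k : 0 <= B i j k.
Proof. by rewrite divr_ge0 // /const_coef mcoeff_mderiv mulrn_wge0. Qed.

Lemma msp_quad_sym i j k : B i j k = B i k j.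
Proof. by rewrite /B /quad_coef mderiv_comm. Qed.

Lemma sys_evalE x i : sys_eval f x i 0 = qeval c L B (fun j => x j 0) i.
Proof.
by rewrite mxE; have [-> _] := second_order_deg_le2 (@f_quadratic i) (fun j => x j 0).
Qed.

Lemma jacobianE x i j : jacobian f x i j = qjac L B (fun k => x k 0) i j.
Proof.
by rewrite mxE; have [_ ->] := second_order_deg_le2 (@f_quadratic i) (fun k => x k 0).
Qed.

Lemma qjac_mderiv (x : 'I_n -> R) i j : qjac L B x i j = meval x (mderiv j (f i)).
Proof. by have [_ ->] := second_order_deg_le2 (@f_quadratic i) x. Qed.

(** The derivative is a nonzero polynomial with nonnegative coefficients, hence positive at a
    positive point. *)
Lemma qjac_dep_gt0 (x : 'I_n -> R) i j : (forall k, 0 < x k) ->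
  depends_directly f i j -> 0 < qjac L B x i j.
Proof.
move=> x0 dij; rewrite qjac_mderiv mevalE.
have term_gt0 m : m \in msupp (mderiv j (f i)) ->
    0 < mcoeff m (mderiv j (f i)) * \prod_k x k ^+ m k.
  rewrite mcoeff_msupp => m0; rewrite mulr_gt0 //.
    by rewrite lt_neqAle eq_sym m0 mderiv_coef_ge0.
  by apply: prodr_gt0 => k _; rewrite exprn_gt0.
move: dij term_gt0; rewrite /depends_directly -msupp_eq0.
case: (msupp _) => // m s _ term_gt0; rewrite big_cons; apply: ltr_wpDr.
  by rewrite big_seq; apply: sumr_ge0 => m' m's; rewrite ltW // term_gt0 // in_cons m's orbT.
by apply: term_gt0; rewrite mem_head.
Qed.

Lemma qjac_mderiv0 (x : 'I_n -> R) i j : ~~ depends_directly f i j -> qjac L B x i j = 0.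
Proof. by rewrite qjac_mderiv negbK => /eqP ->; rewrite meval0. Qed.

Lemma iter_sys_evalE k i :
  iter k (sys_eval f) 0 i 0 = iter k (qeval c L B) (fun=> 0) i.
Proof.
elim: k i => [|k IHk] i /=; first by rewrite mxE.
by rewrite sys_evalE; congr (qeval c L B _ i); apply/funext => j; exact: IHk.
Qed.

Lemma nonneg_fixpointP x : nonneg_fixpoint f x <->
  (forall i, 0 <= x i 0) /\ forall i, qeval c L B (fun j => x j 0) i = x i 0.
Proof.
split=> [[x0 xfix]|[x0 xfix]]; split.
- by move=> i; have := x0 i; rewrite mxE.
- by move=> i; rewrite -sys_evalE xfix.
- by move=> i; rewrite mxE.
by apply/colP => i; rewrite sys_evalE.
Qed.

(** Every damped iterate lies below every nonnegative fixed point, so the limit is the least one. *)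
Lemma lfp_damped_kleene : feasible f ->
  least_nonneg_fixpoint f (lfp f) /\
  forall i, (damped_kleene c L B k i @[k --> \oo] --> lfp f i 0)%classic.
Proof.
move=> [z /nonneg_fixpointP[z0 zfix]].
have [mu [mu0 mufix ymu]] := damped_kleene_cvg msp_const_ge0 msp_lin_ge0 msp_quad_ge0 z0 zfix.
have muE : (fun j => (\col_i mu i) j (0 : 'I_1)) = mu by apply/funext => j; rewrite mxE.
have least : least_nonneg_fixpoint f (\col_i mu i).
  split; first by apply/nonneg_fixpointP; split=> i; rewrite ?muE mxE.
  move=> x /nonneg_fixpointP[x0 xfix] i; rewrite mxE.
  apply: (cvgr_to_le (ymu i)); apply: nearW => k.
  exact: (damped_kleene_le_fix msp_const_ge0 msp_lin_ge0 msp_quad_ge0 k i x0 xfix).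
have lfpP : least_nonneg_fixpoint f (lfp f).
  by apply: (@xgetPex _ 0 [set m | least_nonneg_fixpoint f m]%classic); exists (\col_i mu i).
split=> // i; suff -> : lfp f i 0 = mu i by exact: ymu.
have [lfp1 lfp2] := lfpP; have [least1 least2] := least.
apply/eqP; rewrite eq_le; have := lfp2 _ least1 i; have := least2 _ lfp1 i.
by rewrite mxE => -> ->.
Qed.

End QuadraticMSP.

(** * Transfer to the Newton sequence *)

Section NewtonConvergence.
Variables (R : realType) (n : nat) (f : polysys R n).
Hypotheses (f_msp : monotone_system f) (f_quadratic : quadratic f).
Hypotheses (f_clean : clean f) (f_feasible : feasible f).

Lemma lfp_gt0 i : 0 < lfp f i 0.
Proof.
have [[/(nonneg_fixpointP f_quadratic)[mu0 mufix] _] _] :=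
  lfp_damped_kleene f_msp f_quadratic f_feasible.
have [k] := f_clean i; rewrite (iter_sys_evalE f_quadratic) => /lt_le_trans; apply.
by have /andP[] := iter_qeval_bound (msp_const_ge0 f_msp) (msp_lin_ge0 f_msp)
  (msp_quad_ge0 f_msp) k i mu0 mufix.
Qed.

Lemma newton_convergence :
  newton_seq_well_defined f /\
  exists2 C, 0 <= C & forall k i,
    0 <= lfp f i 0 - newton_seq f k i 0 <= C * newton_rate R (height f) ^+ k.
Proof.
have [[/(nonneg_fixpointP f_quadratic)[_ mufix] _] ymu] :=
  lfp_damped_kleene f_msp f_quadratic f_feasible.
pose c i := const_coef (f i).
pose L i j := lin_coef (f i) j.
pose B i j k := quad_coef (f i) j k.
pose mu i := lfp f i 0.
have c0 : forall i, 0 <= c i := msp_const_ge0 f_msp.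
have L0 : forall i j, 0 <= L i j := msp_lin_ge0 f_msp.
have B0 : forall i j k, 0 <= B i j k := msp_quad_ge0 f_msp.
have Bsym : forall i j k, B i j k = B i k j := @msp_quad_sym _ _ f.
have mu0 : forall i, 0 < mu i := lfp_gt0.
have [a [a0 a1 depJ]] : exists a, [/\ 0 < a, a <= 1 &
    forall i j, depends_directly f i j -> 2 * a <= qjac L B mu i j].
  (* [a] bounds from below half of each Jacobian entry along a dependency. *)
  have [|a [a0 a1 aP]] := @exists_lower_bound R _
    [pred ij : 'I_n * 'I_n | depends_directly f ij.1 ij.2]
    (fun ij => qjac L B mu ij.1 ij.2 / 2).
    by move=> [i j] /= dij; rewrite divr_gt0 //; exact: (qjac_dep_gt0 f_msp f_quadratic).
  exists a; split=> // i j dij; have /= := aP (i, j) dij; lra.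
have ndepJ i j : ~~ depends_directly f i j -> qjac L B mu i j = 0.
  exact: (qjac_mderiv0 f_quadratic).
have [d [d0 dsub]] := exists_subinvariant c0 L0 B0 Bsym mu0 mufix ymu a0 a1 depJ.
have cln i : exists k, 0 < iter k (qeval c L B) (fun=> 0) i.
  by have [k] := f_clean i; rewrite (iter_sys_evalE f_quadratic); exists k.
pose inv := newton_inv c L B (depends_directly f) mu.
have inv_unit (x : 'cV[R]_n) : inv (fun i => x i 0) -> 1%:M - jacobian f x \in unitmx.
  (* Invertibility follows from a trivial kernel; the transposition is there because [inj_row_free]
     speaks of row vectors. *)
  move=> xinv; rewrite -unitmx_tr -row_free_unit; apply: inj_row_free => w.
  move=> /(congr1 trmx); rewrite trmx_mul trmxK trmx0 => Jw.
  have w0 := newton_inv_kernel c0 L0 B0 Bsym mu0 mufix a0 a1 depJ ndepJ d0 dsub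
    (@level_eq R n f) (@level_lt R n f) cln xinv.
  apply/rowP => i; rewrite mxE; apply: (w0 (fun i => w 0 i)) => k.
  have /colP/(_ k) := Jw; rewrite mulmxBl mul1mx !mxE => /eqP; rewrite subr_eq0 => /eqP ->.
  by apply: eq_bigr => j _; rewrite (jacobianE f_quadratic) mxE.
have unit_step (x : 'cV[R]_n) : 1%:M - jacobian f x \in unitmx ->
    newton_step c L B (fun i => x i 0) (fun i => newton f x i 0).
  move=> Ju i.
  have : (1%:M - jacobian f x) *m (newton f x - x) = sys_eval f x - x.
    by rewrite /newton addrAC subrr add0r mulKVmx.
  have subE (u v : 'cV[R]_n) k : (u - v) k 0 = u k 0 - v k 0 by rewrite !mxE.
  move=> /colP/(_ i); rewrite mulmxBl mul1mx !subE (sys_evalE f_quadratic).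
  have -> : (jacobian f x *m (newton f x - x)) i 0 =
      \sum_j qjac L B (fun i => x i 0) i j * (newton f x j 0 - x j 0).
    by rewrite mxE; apply: eq_bigr => j _; rewrite (jacobianE f_quadratic) subE.
  by move=> <-; rewrite subrKC.
pose nu k i := newton_seq f k i 0.
(* The invariant makes the matrix invertible, so the next iterate is a genuine Newton step, which
   preserves the invariant. *)
have nu_inv k : inv (nu k).
  elim: k => [|k IHk].
    have -> : nu 0%N = fun=> 0 by apply/funext => i; rewrite /nu mxE.
    split=> // i; first exact: ltW.
    exact: qeval_ge0.
  have [] := newton_step_inv c0 L0 B0 Bsym mu0 mufix a0 a1 depJ ndepJ d0 dsub
    (@level_eq R n f) (@level_lt R n f) cln IHk (unit_step _ (inv_unit _ IHk)).
  by [].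
have nu_unit k := inv_unit _ (nu_inv k).
split=> [k|].
  split; last exact: nu_unit.
  by move=> i; rewrite mxE; have [nu0 _ _ _] := nu_inv k; exact: nu0.
have [C C0 CP] := newton_level_rate c0 L0 B0 Bsym mu0 mufix a0 a1 depJ ndepJ d0 dsub
    (@level_eq R n f) (@level_lt R n f) cln nu_inv (fun k => unit_step _ (nu_unit k))
    (erefl _ : newton_rate R 0 = 2^-1) (@newton_rateS R) (@newton_rate_bound R) (height f).
exists C => // k i; apply/andP; split.
  by rewrite subr_ge0; have [_ numu _ _] := nu_inv k; exact: numu.
(* Levels never exceed the height, so the rate at level [height f] serves every coordinate. *)
by apply: CP; exact: leq_subr.
Qed.

End NewtonConvergence.

Theorem theorem6p2 (R : realType) (n : nat) (f : polysys R n)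
    (f_msp : monotone_system f) (f_quadratic : quadratic f)
    (f_clean : clean f) (f_feasible : feasible f) :
  [/\ newton_seq_well_defined f,
      converges_linearly (newton_seq f) (lfp f) &
      exists kf : nat, forall i : nat,
        valid_bits (lfp f)
          (newton_seq f (kf + i * ((height f).+1 * 2 ^ height f))%N) i].
Proof.
have [wd [C C0 CP]] := newton_convergence f_msp f_quadratic f_clean f_feasible.
have mu0 := lfp_gt0 f_msp f_quadratic f_clean f_feasible.
set r := newton_rate R (height f) in CP.
have r0 : 0 < r by exact: newton_rate_gt0.
have r1 : r < 1 by exact: newton_rate_lt1.
have err k i : `|newton_seq f k i 0 - lfp f i 0| <= C * r ^+ k.
  by rewrite distrC; have /andP[h1 h2] := CP k i; rewrite ger0_norm.
split=> //.
  split; last by exists C, r; split=> //; exact: ltW.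
  apply: (cvg_colvec err); rewrite -[X in (_ --> X)%classic](mulr0 C).
  by apply: cvgM; [exact: cvg_cst | apply: cvg_expr; rewrite gtr0_norm].
(* A common lower bound [m] of the entries turns absolute into relative errors; [kf] brings
   [C * r ^+ kf] below it. *)
have [m [m0 _ mP]] := exists_lower_bound (P := predT) (fun i _ => mu0 i).
have [kf kfP] := pow_lt_eventually C (ltW r0) r1 m0.
exists kf => i j; rewrite distrC (gtr0_norm (mu0 j)) ler_pdivrMr //.
apply: le_trans (err _ _) _; rewrite exprD mulrA mulrC.
(* As [r ^+ (2 ^ h) = 2^-1] for the height [h], the left side is [2 ^- ((h + 1) * i)]. *)
have rpow : r ^+ (i * ((height f).+1 * 2 ^ height f)) <= 2 ^- i.
  rewrite mulnCA mulnA mulnC exprM newton_rate_pow exprVn lef_pV2 ?posrE ?exprn_gt0 //.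
  by apply: ler_weXn2l; rewrite ?ler1n // mulnC leq_pmulr.
apply: ler_pM => //; first exact/exprn_ge0/ltW.
  by rewrite mulr_ge0 // exprn_ge0 // ltW.
exact: le_trans kfP (mP j isT).
Qed.
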